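(* Let $k,n\in\mathbb{N}$ with $k\le n$. Let $\lambda=(\lambda_1,\dots,\lambda_l)$ and $\mu=(\mu_1,\dots,\mu_m)$ be strict partitions, written as strictly decreasing sequences with $\lambda_l>0$ and $\mu_m\ge 0$, such that $\lambda\supset\mu$, $l\ge 2$ and $l+m$ is even. Then \[ Q^{(k,n-k)}_{\lambda/\mu}(x_1,\dots,x_n)=\operatorname{Pf}\begin{bmatrix} M & N\\ -{}^tN & O\end{bmatrix}, \] where $M=\bigl[Q^{(k,n-k)}_{(\lambda_i,\lambda_j)}(x_1,\dots,x_n)\bigr]_{i,j=1}^{l}$ is an $l\times l$ matrix, $N=\bigl[Q^{(k,n-k)}_{(\lambda_i-\mu_{m+1-j})}(x_1,\dots,x_n)\bigr]_{1\le i\le l,\,1\le j\le m}$ is an $l\times m$ matrix, ${}^tN$ is the transpose of $N$, and $O$ is the $m\times m$ zero matrix.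
   Context: $\mathbb{N}=\{0,1,2,\dots\}$. Partitions differing only by trailing zeros are identified; a partition is strict if its nonzero parts are distinct; $\ell(\lambda)$ is the number of nonzero parts; $\lambda\supset\mu$ means $\lambda_i\ge\mu_i$ for all $i$ (missing entries being $0$). $\operatorname{Pf}$ denotes the Pfaffian of a skew-symmetric matrix of even size. Shifted diagrams: for a strict partition $\lambda$, $S(\lambda)=\{(i,j)\in\mathbb{Z}^2\mid 1\le i\le\ell(\lambda),\ i\le j\le\lambda_i+i-1\}$, with $i$ the row index (increasing from top to bottom) and $j$ the column index (increasing from left to right). For strict partitions $\lambda\supset\mu$, $S(\lambda/\mu)=S(\lambda)\setminus S(\mu)$. The main diagonal consists of the cells $(i,i)$. Tableaux: for $k\le n$ and strict partitions $\lambda\supset\mu$, $\mathrm{QTab}^{(k,n-k)}(\lambda/\mu)$ is the set of fillings of the cells of $S(\lambda/\mu)$ with entries in the totally ordered set \[ \{1'<1<\overline{1}'<\overline{1}<2'<2<\overline{2}'<\overline{2}<\cdots<k'<k<\overline{k}'<\overline{k}<(k+1)'<k+1<\cdots<n'<n\} \] such that: (1) entries in each row weakly increase from left to right; (2) entries in each column weakly increase from top to bottom; (3) each row contains at most one $i'$ and at most one $\overline{j}'$ for each $i\in\{1,\dots,n\}$ and $j\in\{1,\dots,k\}$; (4) each column contains at most one $i$ and at most one $\overline{j}$ for each $i\in\{1,\dots,n\}$ and $j\in\{1,\dots,k\}$; (5) the $i$-th entry on the main diagonal is one of $\{i',i,\overline{i}',\overline{i}\}$ for each $i\in\{1,\dots,k\}$.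 Intermediate symplectic $Q$-polynomial: for strict partitions $\lambda\supset\mu$, \[ Q^{(k,n-k)}_{\lambda/\mu}(x_1,\dots,x_n)=\sum_{T\in\mathrm{QTab}^{(k,n-k)}(\lambda/\mu)}x^T,\qquad x^T=\prod_{i=1}^k x_i^{m(i')+m(i)-m(\overline{i}')-m(\overline{i})}\prod_{j=k+1}^n x_j^{m(j')+m(j)}, \] where $m(\gamma)$ is the multiplicity of the entry $\gamma$ in $T$. Write $Q^{(k,n-k)}_\lambda=Q^{(k,n-k)}_{\lambda/\emptyset}$. Conventions for the matrix entries: $Q^{(k,n-k)}_{(0)}=1$, $Q^{(k,n-k)}_{(r)}=0$ for $r<0$; $Q^{(k,n-k)}_{(s,r)}=-Q^{(k,n-k)}_{(r,s)}$ for $r>s>0$, and $Q^{(k,n-k)}_{(r,r)}=0$.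
   Formalization: Tableau condition (5) is replaced by: for each i in {1,…,k}, at most one main-diagonal entry is one of i', i, ī', ī. With (5) as worded the formula fails, e.g. k=1, n=2, λ=(3,1), μ=(2,1): left side 2(x_1+1/x_1+x_2), Pfaffian 2(x_1+1/x_1). *)

(* Defs.v *)
(* MathComp *)
From HB Require Import structures.
From mathcomp Require Import all_boot all_order all_fingroup all_algebra.
Set Implicit Arguments.
Unset Strict Implicit.
Unset Printing Implicit Defensive.
Import GRing.Theory.
Local Open Scope ring_scope.

(* Partitions are sequences of naturals, read through [nth 0%N], so trailing
   zeros are irrelevant.  Rows and columns of a diagram are numbered from 0. *)
Definition contains (la mu : seq nat) : Prop :=
  forall i : nat, (nth 0 mu i <= nth 0 la i)%N.

Definition shifted_diagram (la : seq nat) : seq (nat * nat) :=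
  [seq (i, j) | i <- iota 0 (size la), j <- iota i (nth 0%N la i)].

Definition skew_diagram (la mu : seq nat) : seq (nat * nat) :=
  [seq c <- shifted_diagram la | c \notin shifted_diagram mu].

(* [(i, b, p)] is the letter of value i + 1, barred iff b and primed iff p. *)
Definition letter (n : nat) : Type := ('I_n * bool * bool)%type.
Definition value n (a : letter n) : 'I_n := a.1.1.
Definition barred n (a : letter n) : bool := a.1.2.
Definition primed n (a : letter n) : bool := a.2.

(* i' < i < \bar i' < \bar i < (i+1)' *)
Definition rank n (a : letter n) : nat :=
  (4 * value a + 2 * barred a + ~~ primed a)%N.

Section Tableaux.
Variables (k n : nat) (la mu : seq nat).

Definition cell : Type := seq_sub (skew_diagram la mu).
Definition row_of (c : cell) : nat := (val c).1.
Definition col_of (c : cell) : nat := (val c).2.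
Definition filling : Type := {ffun cell -> letter n}.

Definition alphabet_cond (T : filling) : bool :=
  [forall c, barred (T c) ==> (value (T c) < k)%N].

Definition row_weak (T : filling) : bool :=
  [forall c, forall d, (row_of c == row_of d) && (col_of c <= col_of d)%N ==>
    (rank (T c) <= rank (T d))%N].

Definition col_weak (T : filling) : bool :=
  [forall c, forall d, (col_of c == col_of d) && (row_of c <= row_of d)%N ==>
    (rank (T c) <= rank (T d))%N].

Definition row_primed (T : filling) : bool :=
  [forall c, forall d, [&& c != d, row_of c == row_of d & primed (T c)] ==>
    (T c != T d)].

Definition col_unprimed (T : filling) : bool :=
  [forall c, forall d, [&& c != d, col_of c == col_of d & ~~ primed (T c)] ==>
    (T c != T d)].

(* For each i <= k, the main diagonal carries at most one entry among
   i', i, \bar i', \bar i.  Pitfall: the condition "the i-th entry on the main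
   diagonal is one of i', i, \bar i', \bar i for i <= k" is not equivalent to
   this, and the Pfaffian formula fails for it: for k = 1, n = 2,
   la = (3, 1), mu = (2, 1), the only cell of la / mu is off the diagonal, so
   that Q_(la / mu) = 2 (x_1 + x_1^-1 + x_2), while the Pfaffian is equal to
   Q_((1)), which would be 2 (x_1 + x_1^-1). *)
Definition diag_cond (T : filling) : bool :=
  [forall c, forall d,
    [&& c != d, row_of c == col_of c, row_of d == col_of d
      & (value (T c) < k)%N] ==> (value (T c) != value (T d))].

Definition is_qtab (T : filling) : bool :=
  [&& alphabet_cond T, row_weak T, col_weak T, row_primed T, col_unprimed T
    & diag_cond T].

Definition mult (T : filling) (a : letter n) : nat := #|[set c | T c == a]|.

Definition weight (R : comUnitRingType) (x : 'I_n -> R) (T : filling) : R :=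
  (\prod_(i < n | (i < k)%N)
     x i ^ ((mult T (i, false, true))%:Z + (mult T (i, false, false))%:Z
            - (mult T (i, true, true))%:Z - (mult T (i, true, false))%:Z))
  * \prod_(j < n | (k <= j)%N)
      x j ^+ (mult T (j, false, true) + mult T (j, false, false)).

End Tableaux.

(* The Laurent polynomial Q^(k, n-k)_(la / mu), evaluated at a point x of a
   commutative ring in which x_1, ..., x_k are meant to be invertible. *)
Definition Qskew (R : comUnitRingType) (k n : nat) (x : 'I_n -> R)
    (la mu : seq nat) : R :=
  \sum_(T : filling n la mu | is_qtab k T) weight k x T.

(* For r = 0 the sum has exactly one term, the empty tableau, and equals 1. *)
Definition Qrow (R : comUnitRingType) (k n : nat) (x : 'I_n -> R)
    (r : int) : R :=
  if r is Posz r' then Qskew k x [:: r'] [::] else 0.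

Definition Qpair (R : comUnitRingType) (k n : nat) (x : 'I_n -> R)
    (r s : nat) : R :=
  if (s < r)%N then Qskew k x [:: r; s] [::]
  else if (r < s)%N then - Qskew k x [:: s; r] [::]
  else 0.

(* Perfect matchings of {0, ..., N-1} as permutations s with
   s 0 < s 1, s 2 < s 3, ... and s 0 < s 2 < s 4 < ... *)
Definition matching_perm (N : nat) (s : 'S_N) : bool :=
  [forall i : 'I_N, forall j : 'I_N, ~~ odd i ==>
     (((j == i.+1 :> nat) ==> (s i < s j)%N)
      && (~~ odd j && (i < j)%N ==> (s i < s j)%N))].

(* Meaningful for even N and skew-symmetric A. *)
Definition pfaffian (R : comUnitRingType) (N : nat) (A : 'M[R]_N) : R :=
  \sum_(s : 'S_N | matching_perm s)
    (-1) ^+ s * \prod_(i < N | ~~ odd i) \prod_(j < N | j == i.+1 :> nat)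
                  A (s i) (s j).

(* Main.v *)
Require Import Defs.
From mathcomp Require Import all_boot all_order all_fingroup all_algebra.
From mathcomp Require Import zify.
Set Implicit Arguments.
Unset Strict Implicit.
Unset Printing Implicit Defensive.
Import GRing.Theory.
Local Open Scope ring_scope.

(** Both sides obey the same recursion on the number of values that the entries
    may take.

    Tableau side.  In a tableau of shape [la/mu], the cells of [la] that lie in
    [mu] or carry one of the first [v] values form a strict partition [nu], and
    the entries of value [v+1] fill [la/nu].  By the condition on the diagonal
    these entries open at most one row.  Hence, if all [l] parts of [la] are
    positive, [nu] is a strictly decreasing sequence of length [l], whose last
    entry may be 0.  Inside one value the letters are removed one by one: an
    unprimed letter occupies a horizontal strip, a primed one a vertical strip.

    For a function [F] on sequences of naturals put
      conv g F (a_1,...,a_l) = sum over b_i <= a_i of prod_i g(a_i - b_i) F(b).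
    If [F] is alternating and [la] is strict, then the sum of y^|la/ka| F(ka) over
    the horizontal strips la/ka is [conv g F la] with g(r) = y^r, because all the
    other terms cancel by row operations; for vertical strips the same holds with
    g = (1, y, 0, 0, ...) ([conv_letter_step]).  Thus the passage from [v] to [v+1]
    values is a composition of operators [conv], applied to any alternating
    function that extends the generating function of the smaller tableaux
    ([sum_letters], [value_step]).

    Pfaffian side.  The Pfaffian of the matrix [A a_i a_j] is an alternating and
    multilinear function of the sequence of indices, so that [conv] only changes
    the matrix [A] ([kernel_conv_seq_pf], [alternating_seq_pf]).  The tableau
    recursion for shapes with one and with two rows says that the matrix attached
    to [v+1] values is the one obtained in this way from the matrix attached to [v]
    values ([seq_pf_step]).  So the two recursions agree, and the induction
    ([Qgrid_seq_pf]) starts from the fact that without any letter both sides are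
    the Kronecker symbol of [la] and [mu] ([seq_pf_base], [Qgrid_base]).

    The induction needs the formula for the sequences [nu] ending in 0, while it is
    known for positive ones.  If 0 is not a part of [mu], the final 0 of [nu] gives
    the same row of the matrix as a part 0 of [mu], and is moved there; otherwise
    the two zeros are paired with each other ([seq_pf_move_zero],
    [seq_pf_cancel_zeros]).

    Pfaffians are computed on sequences of indices, by expansion along the first
    index; [pfaffian_seq_pf] identifies this with the sum over matchings. *)

(** * Strictly decreasing sequences *)

Lemma gtn_trans : transitive gtn.
Proof. by move=> y x z /= yx zy; apply: ltn_trans yx. Qed.

Lemma sorted_gtn_cons a s : sorted gtn (a :: s) = all (ltn^~ a) s && sorted gtn s.
Proof. by rewrite /= (path_sortedE gtn_trans). Qed.

Lemma sorted_gtn_rcons s a : sorted gtn (rcons s a) = all (gtn^~ a) s && sorted gtn s.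
Proof. by rewrite !(sorted_pairwise gtn_trans) pairwise_rcons. Qed.

Lemma sorted_gtnP s :
  reflect (forall i, (i.+1 < size s)%N -> (nth 0 s i.+1 < nth 0 s i)%N) (sorted gtn s).
Proof. exact: sortedP. Qed.

Lemma unsorted_step s : ~~ sorted gtn s ->
  exists2 i, (i.+1 < size s)%N & (nth 0 s i <= nth 0 s i.+1)%N.
Proof.
elim: s => //= a [|b s] // IH.
by rewrite negb_and -leqNgt => /orP[ab|/IH[i si le]]; [exists 0%N|exists i.+1].
Qed.

Lemma split_zero s : sorted gtn s -> 0%N \in s ->
  exists s', [/\ s = rcons s' 0%N, 0%N \notin s' & sorted gtn s'].
Proof.
elim/last_ind: s => // s a _; rewrite sorted_gtn_rcons mem_rcons inE.
move=> /andP[/allP gta ss] /orP[/eqP a0|/gta //]; exists s; split; rewrite ?a0 //.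
by apply/negP => /gta; rewrite -a0.
Qed.

(** * Pfaffians as functions of the sequence of indices *)

Section Contraction.
Variables (R : comUnitRingType) (I : eqType).
Implicit Types (A : I -> I -> R) (F : seq I -> R) (s t : seq I) (x y : I).

(** Expansion along an extra first index [x]: the signed sum, over the entries [y]
    of [s], of [A x y] times the value of [F] at [s] without [y].  Recursion on [s]
    carries the sign, and no position has to be named. *)
Fixpoint contr A x F s : R :=
  if s is y :: t then A x y * F t - contr A x (fun u => F (y :: u)) t else 0.

(** The Pfaffian of the matrix [A s_i s_j], for [s] of size [2 m]; it is 0 for
    every other size. *)
Fixpoint seq_pf A m s : R :=
  if m is m'.+1 then if s is x :: t then contr A x (seq_pf A m') t else 0
  else (s == [::])%:R.

Lemma contr_eq_in A A' x F F' s :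
  (forall y, y \in s -> A x y = A' x y) ->
  (forall u, subseq u s -> F u = F' u) -> contr A x F s = contr A' x F' s.
Proof.
elim: s F F' => // y s IH F F' eA eF /=.
rewrite eA ?mem_head // (eF s) ?subseq_cons //; congr (_ - _); apply: IH => [z zs|u us].
  by rewrite eA // inE zs orbT.
by rewrite eF //= eqxx.
Qed.

Lemma contr_ext A x F F' s : F =1 F' -> contr A x F s = contr A x F' s.
Proof. by move=> eF; apply: contr_eq_in => // u _; apply: eF. Qed.

Lemma contrD A x F F' s :
  contr A x (fun u => F u + F' u) s = contr A x F s + contr A x F' s.
Proof.
elim: s F F' => [|y s IH] F F' /=; first by rewrite addr0.
by rewrite (IH (fun u => F (y :: u))) mulrDr opprD !addrA; congr (_ - _); rewrite addrAC.
Qed.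

Lemma contrZ A x c F s : contr A x (fun u => c * F u) s = c * contr A x F s.
Proof.
elim: s F => [|y s IH] F /=; first by rewrite mulr0.
by rewrite (IH (fun u => F (y :: u))) mulrBr mulrCA.
Qed.

Lemma contrN A x F s : contr A x (fun u => - F u) s = - contr A x F s.
Proof.
rewrite -[RHS]mulN1r -contrZ; apply: contr_ext => u; by rewrite mulN1r.
Qed.

Lemma contrB A x F F' s :
  contr A x (fun u => F u - F' u) s = contr A x F s - contr A x F' s.
Proof. by rewrite contrD contrN. Qed.

Lemma contr0 A x s : contr A x (fun=> 0) s = 0.
Proof. by elim: s => //= y s ->; rewrite mulr0 subr0. Qed.

Lemma contr_sum A x (J : Type) (r : seq J) (G : J -> seq I -> R) s :
  contr A x (fun u => \sum_(j <- r) G j u) s = \sum_(j <- r) contr A x (G j) s.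
Proof.
elim: r => [|j r IH].
  by rewrite big_nil -[RHS](contr0 A x s); apply: contr_ext => u; rewrite big_nil.
rewrite big_cons -IH -contrD; apply: contr_ext => u; by rewrite big_cons.
Qed.

(** Contractions anticommute, like odd derivations of an exterior algebra; with
    [contr_sq] this is the source of all the alternation below.  The square is
    treated apart, since 2 may be a zero divisor. *)
Lemma contrC A x y F s :
  contr A x (contr A y F) s = - contr A y (contr A x F) s.
Proof.
elim: s F => [|z s IH] F /=; first by rewrite oppr0.
by rewrite !contrB !contrZ IH !opprB !addrA.
Qed.

Lemma contr_sq A x F s : contr A x (contr A x F) s = 0.
Proof.
elim: s F => [|z s IH] F //=; by rewrite contrB contrZ IH subr0 subrr.
Qed.

Lemma contr_row0 A x F s : (forall y, y \in s -> A x y = 0) -> contr A x F s = 0.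
Proof.
elim: s F => //= y s IH F A0; rewrite A0 ?mem_head // mul0r sub0r IH ?oppr0 // => z zs.
by rewrite A0 // inE zs orbT.
Qed.

Lemma contr_row1 A x F s y t :
  (forall z, z \in s ++ t -> A x z = 0) ->
  contr A x F (s ++ y :: t) = (-1) ^+ size s * A x y * F (s ++ t).
Proof.
elim: s F => [|z s IH] F A0 /=.
  by rewrite contr_row0 // subr0 expr0 mul1r.
rewrite A0 ?mem_head // mul0r sub0r IH; last by move=> u us; rewrite A0 // inE us orbT.
by rewrite exprS !mulN1r !mulNr.
Qed.

(** Alternation in adjacent places is stated for given indices, because a matrix
    may be skew-symmetric on a part of its indices only. *)
Definition swaps (a b : I) F :=
  forall s t, F (s ++ a :: b :: t) = - F (s ++ b :: a :: t).
Definition kills (a : I) F := forall s t, F (s ++ a :: a :: t) = 0.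

Lemma swaps_contr A x a b F : swaps a b F -> swaps a b (contr A x F).
Proof.
move=> sF s t; elim: s F sF => [|y s IH] F sF /=.
  rewrite !opprB (@contr_ext _ _ _ (fun u => - F [:: b, a & u])) ?contrN ?addrA //.
  by move=> u; apply: (sF [::]).
rewrite sF IH; first by rewrite mulrN opprK opprB addrC.
by move=> u v; apply: (sF (y :: u)).
Qed.

Lemma kills_contr A x a F : kills a F -> kills a (contr A x F).
Proof.
move=> kF s t; elim: s F kF => [|y s IH] F kF /=.
  rewrite (@contr_ext _ _ _ (fun u => 0)) ?contr0; last by move=> u; apply: (kF [::]).
  by rewrite subr0 subrr.
rewrite kF IH ?mulr0 ?subr0 // => u v; exact: (kF (y :: u)).
Qed.

Lemma swaps_seq_pf A a b m : A a b = - A b a -> swaps a b (seq_pf A m).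
Proof.
move=> Aab; elim: m => [|m IH] [|x s] t; rewrite ?oppr0 //=; last exact: swaps_contr.
case: m IH => [|m] IH /=; rewrite Aab mulNr opprD; congr (_ + _); rewrite ?opprK.
  by rewrite !contr0 oppr0.
by rewrite -[RHS]opprK; congr (- _); exact: contrC.
Qed.

Lemma kills_seq_pf A a m : A a a = 0 -> kills a (seq_pf A m).
Proof.
move=> Aa; elim: m => [|m IH] [|x s] t //=; last exact: kills_contr.
by rewrite Aa mul0r sub0r; case: m IH => [|m] IH /=; rewrite ?contr0 ?contr_sq oppr0.
Qed.

(** Only the entries above the diagonal enter a Pfaffian. *)
Lemma eq_seq_pf A A' m s :
  pairwise (fun x y => A x y == A' x y) s -> seq_pf A m s = seq_pf A' m s.
Proof.
elim: m s => [|m IH] [|x s] //= /andP[/allP xs ps].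
apply: contr_eq_in => [y /xs /eqP //|u us]; apply: IH; exact: subseq_pairwise ps.
Qed.

Lemma seq_pf_ext A A' m s : A =2 A' -> seq_pf A m s = seq_pf A' m s.
Proof.
move=> eA; apply: eq_seq_pf; elim: s => //= x s ->; rewrite andbT.
by apply/allP => y _; rewrite eA.
Qed.

End Contraction.

Lemma contr_map (R : comUnitRingType) (I J : eqType) (f : J -> I) (A : I -> I -> R)
    x F s :
  contr A (f x) F (map f s)
  = contr (fun i j => A (f i) (f j)) x (fun u => F (map f u)) s.
Proof. by elim: s F => //= y s IH F; rewrite IH. Qed.

Lemma seq_pf_map (R : comUnitRingType) (I J : eqType) (f : J -> I) (A : I -> I -> R)
    m s :
  seq_pf A m (map f s) = seq_pf (fun i j => A (f i) (f j)) m s.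
Proof.
elim: m s => [|m IH] [|x s] //=; rewrite contr_map; exact: contr_ext.
Qed.

(** * The sum over perfect matchings *)

Section Matchings.
Variable R : comUnitRingType.

Lemma contr_enum (I : eqType) (A : I -> I -> R) x F N (f : 'I_N.+1 -> I) :
  contr A x F (map f (enum 'I_N.+1))
  = \sum_(j < N.+1) (-1) ^+ j * A x (f j) * F [seq f (lift j i) | i <- enum 'I_N].
Proof.
elim: N F f => [|N IH] F f.
  rewrite big_ord1 enum_ordSl /= (eqP (_ : enum 'I_0 == [::])) ?subr0 ?mul1r //.
  by rewrite -size_eq0 size_enum_ord.
rewrite enum_ordSl /= -map_comp big_ord_recl expr0 mul1r; congr (_ + _).
rewrite IH -sumrN; apply: eq_bigr => j _.
rewrite /= /bump leq0n exprS !mulNr mul1r; congr (- (_ * _ * F _)).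
rewrite enum_ordSl /=; congr (_ :: _).
  by congr f; apply/val_inj.
rewrite -map_comp; apply: eq_map => i /=; congr f; apply/val_inj.
by rewrite /= /bump /= !add1n ltnS addnS.
Qed.

Lemma matching_permP N (s : 'S_N) :
  reflect ((forall i j : 'I_N, ~~ odd i -> j = i.+1 :> nat -> (s i < s j)%N) /\
           (forall i j : 'I_N, ~~ odd i -> ~~ odd j -> (i < j)%N -> (s i < s j)%N))
    (matching_perm s).
Proof.
apply: (iffP idP) => [/forallP h|[h1 h2]].
  by split=> [i j oi /eqP ij|i j oi oj ij]; move/forallP: (h i) => /(_ j);
    rewrite oi /= => /andP[]; rewrite ?ij ?oj /=.
apply/forallP=> i; apply/forallP=> j; apply/implyP=> oi; apply/andP; split.
  by apply/implyP=> /eqP; apply: h1.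
by apply/implyP=> /andP[oj ij]; apply: h2.
Qed.

(** The least point opens the first pair: any other place of 0 contradicts one of
    the two monotonicity conditions. *)
Lemma matching_perm0 N (s : 'S_N.+1) : matching_perm s -> s ord0 = ord0.
Proof.
move=> /matching_permP[h1 h2].
set p := (s^-1)%g ord0; have sp : s p = ord0 by rewrite permKV.
have [op|op] := boolP (odd p).
  have p0 : (p.-1.+1 = p)%N by case: (nat_of_ord p) op.
  have pN : (p.-1 < N.+1)%N by rewrite (leq_ltn_trans (leq_pred _)).
  have := h1 (Ordinal pN) p; rewrite sp /= p0 ltn0 => /(_ _ erefl) h.
  by have: false by apply: h; move: op; rewrite -{1}p0 /=.
have [/eqP p0|] := boolP (p == ord0); first by rewrite -[in LHS]p0 sp.
rewrite -val_eqE -lt0n /= => p0.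
by have := h2 ord0 p isT op p0; rewrite sp ltn0.
Qed.

(** Any matching of N + 2 points arises once in this way: 0 is paired with [j+1],
    and the other points are matched by [s], transported by the increasing
    bijection.  As [lift_perm] keeps track of parity, the sign is that of the
    expansion along the first row. *)
Definition addpair N (j : 'I_N.+1) (s : 'S_N) : 'S_N.+2 :=
  lift_perm ord0 ord0 (lift_perm ord0 j s).

Lemma addpair0 N (j : 'I_N.+1) s : addpair j s ord0 = ord0.
Proof. exact: lift_perm_id. Qed.
Lemma addpair1 N (j : 'I_N.+1) s : addpair j s (lift ord0 ord0) = lift ord0 j.
Proof. by rewrite /addpair lift_perm_lift lift_perm_id. Qed.
Lemma addpairS N (j : 'I_N.+1) s (i : 'I_N) :
  addpair j s (lift ord0 (lift ord0 i)) = lift ord0 (lift j (s i)).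
Proof. by rewrite /addpair !lift_perm_lift. Qed.

Lemma ltn_lift N (j : 'I_N.+1) (a b : 'I_N) : (lift j a < lift j b)%N = (a < b)%N.
Proof.
rewrite /= /bump; case: (leqP j a) => ja; case: (leqP j b) => jb;
 rewrite ?add1n ?add0n ?ltnS //.
- rewrite ltnNge (leq_trans (ltnW jb) (leqW ja)); apply/esym/negbTE.
  by rewrite -leqNgt ltnW // (leq_trans jb).
- by rewrite (leq_trans ja) ?(leq_trans ja jb) ?(leq_trans ja) // ltnW // (leq_trans ja jb).
Qed.

Lemma matching_addpair N (j : 'I_N.+1) (s : 'S_N) :
  matching_perm (addpair j s) = matching_perm s.
Proof.
apply/matching_permP/matching_permP => -[h1 h2]; split.
- move=> a b oa ab; have := h1 (lift ord0 (lift ord0 a)) (lift ord0 (lift ord0 b)).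
  rewrite !addpairS !ltn_lift; apply; first by rewrite /= /bump /= negbK.
  by rewrite /= ab.
- move=> a b oa ob ab; have := h2 (lift ord0 (lift ord0 a)) (lift ord0 (lift ord0 b)).
  by rewrite !addpairS !ltn_lift; apply; rewrite /= /bump /= ?negbK.
- move=> a b oa ab.
  case: (unliftP ord0 a) oa ab => [a'|] -> oa ab; last first.
    have -> : b = lift ord0 ord0 by apply/val_inj; rewrite /= ab.
    by rewrite addpair0 addpair1.
  case: (unliftP ord0 a') oa ab => [a''|] -> oa ab //.
  case: (unliftP ord0 b) ab => [b'|] -> ab //.
  case: (unliftP ord0 b') ab => [b''|] -> ab //.
  rewrite !addpairS !ltn_lift; apply: h1; first by move: oa; rewrite /= /bump /= negbK.
  by move: ab => /= [].
- move=> a b oa ob ab.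
  case: (unliftP ord0 b) ob ab => [b'|] -> ob ab //.
  case: (unliftP ord0 b') ob ab => [b''|] -> ob ab //.
  case: (unliftP ord0 a) oa ab => [a'|] -> oa ab; last by rewrite addpair0 addpairS.
  case: (unliftP ord0 a') oa ab => [a''|] -> oa ab //.
  rewrite !addpairS !ltn_lift; apply: h2.
  + by move: oa; rewrite /= /bump /= negbK.
  + by move: ob; rewrite /= /bump /= negbK.
  + by move: ab; rewrite !ltn_lift.
Qed.

Lemma pfaffian_expand N (A : 'M[R]_N.+2) :
  pfaffian A = \sum_(j < N.+1) (-1) ^+ j * A ord0 (lift ord0 j) *
     pfaffian (\matrix_(a, b) A (lift ord0 (lift j a)) (lift ord0 (lift j b))).
Proof.
rewrite /pfaffian.
under [RHS]eq_bigr => j _ do rewrite big_distrr /=.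
rewrite pair_big_dep /=.
pose g (js : 'I_N.+1 * 'S_N) := addpair js.1 js.2.
have ginj : injective g.
  move=> [j s] [j' s'] /permP e.
  have ej : j = j' by move: (e (lift ord0 ord0)); rewrite !addpair1 => /lift_inj.
  subst j'; congr (_, _); apply/permP => i.
  by move: (e (lift ord0 (lift ord0 i))); rewrite /g !addpairS => /lift_inj /lift_inj.
have gsurj (s : 'S_N.+2) : s ord0 = ord0 -> exists js, s = g js.
  move=> s0.
  have u0 i : s (lift ord0 i) != ord0 by rewrite -[X in _ != X]s0 (inj_eq perm_inj) eq_sym neq_lift.
  have u i : {j | s (lift ord0 i) = lift ord0 j}.
    by case: (unliftP ord0 (s (lift ord0 i))) (u0 i) => [j ->|->]; [exists j | rewrite eqxx].
  have inj1 : injective (fun i => sval (u i)).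
    move=> a b /= e; apply: (@lift_inj _ ord0); apply: (@perm_inj _ s).
    by rewrite (svalP (u a)) (svalP (u b)) e.
  set t := perm inj1; set j := t ord0.
  have v0 i : t (lift ord0 i) != j by rewrite (inj_eq perm_inj) eq_sym neq_lift.
  have v i : {p | t (lift ord0 i) = lift j p}.
    by case: (unliftP j (t (lift ord0 i))) (v0 i) => [p ->|->]; [exists p | rewrite eqxx].
  have inj2 : injective (fun i => sval (v i)).
    move=> a b /= e; apply: (@lift_inj _ ord0); apply: (@perm_inj _ t).
    by rewrite (svalP (v a)) (svalP (v b)) e.
  exists (j, perm inj2); apply/permP => i; rewrite /g /=.
  case: (unliftP ord0 i) => [i'|] ->; last by rewrite addpair0.
  have -> : s (lift ord0 i') = lift ord0 (t i') by rewrite permE; exact: (svalP (u i')).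
  case: (unliftP ord0 i') => [i''|] ->; last by rewrite addpair1.
  by rewrite addpairS [perm inj2 _]permE; congr lift; exact: (svalP (v i'')).
rewrite (eq_bigl (fun s => s \in g @: [set js | matching_perm js.2])); last first.
  move=> s; apply/idP/imsetP => [ms|[js]].
    have [js es] := gsurj s (matching_perm0 ms); exists js => //.
    by rewrite inE; move: ms; rewrite es matching_addpair.
  by rewrite inE => mjs ->; rewrite matching_addpair.
rewrite big_imset /=; last by move=> a b _ _; apply: ginj.
apply: eq_big => [js|[j s] _ /=]; first by rewrite inE.
rewrite /g /addpair !odd_lift_perm /= -/(addpair j s) signr_addb signr_odd -!mulrA.
congr (_ * _); rewrite mulrCA; congr (_ * _).
rewrite big_mkcond big_ord_recl /= big_ord_recl /= mul1r.
rewrite (big_pred1 (lift ord0 ord0)) /=; last by [].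
rewrite addpair0 addpair1; congr (_ * _).
rewrite [RHS]big_mkcond; apply: eq_bigr => i _ /=.
rewrite /bump /= !add1n /= negbK; case: ifP => // oi.
rewrite big_mkcond [RHS]big_mkcond big_ord_recl /= big_ord_recl /= /bump /= !mul1r.
apply: eq_bigr => b _; rewrite !add1n !eqSS; case: ifP => // _.
by rewrite !addpairS !mxE.
Qed.

Lemma pfaffian_seq_pf N (A : 'M[R]_N) :
  ~~ odd N -> pfaffian A = seq_pf (fun i j => A i j) N./2 (enum 'I_N).
Proof.
have [m] := ubnP N; elim: m N A => // m IH [|[|N]] A //= Nm oN.
  rewrite /pfaffian (big_pred1 1%g) ?odd_perm1 ?big_ord0 ?mul1r; last first.
    move=> s; have -> : s = 1%g by apply/permP => -[].
    by rewrite /= eqxx; apply/forallP => -[].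
  by rewrite (eqP (_ : enum 'I_0 == [::])) // -size_eq0 size_enum_ord.
rewrite pfaffian_expand enum_ordSl /= contr_enum; apply: eq_bigr => j _.
rewrite IH; [|exact: (leq_trans (leqnSn _))|by move: oN; rewrite negbK].
congr (_ * _); rewrite (@seq_pf_map _ _ _ (fun i => lift ord0 (lift j i))).
by apply: seq_pf_ext => a b; rewrite mxE.
Qed.
End Matchings.

(** * Multilinearity of the Pfaffian *)

Section Kernel.
Variables (R : comUnitRingType) (I : eqType) (K : I -> seq (R * I)).
Implicit Types (A : I -> I -> R) (F : seq I -> R) (s t : seq I) (x y : I).

(** Every index [x] is replaced by the formal linear combination [K x] of indices.
    [kernel_conv] is the multilinear extension to functions on sequences, and
    [kernel_mx] the bilinear one to matrices. *)
Definition kernel_sum x (f : I -> R) : R := \sum_(p <- K x) p.1 * f p.2.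

Fixpoint kernel_conv F s : R :=
  if s is x :: t then kernel_sum x (fun y => kernel_conv (fun u => F (y :: u)) t) else F [::].

Definition kernel_mx A x y : R := kernel_sum x (fun x' => kernel_sum y (A x')).

Lemma eq_kernel_sum x f f' : f =1 f' -> kernel_sum x f = kernel_sum x f'.
Proof. by move=> ef; apply: eq_bigr => p _; rewrite ef. Qed.

Lemma kernel_sumB x f f' : kernel_sum x (fun y => f y - f' y) = kernel_sum x f - kernel_sum x f'.
Proof. by rewrite -sumrB; apply: eq_bigr => p _; rewrite mulrBr. Qed.

Lemma kernel_sumZr x f c : kernel_sum x (fun y => f y * c) = kernel_sum x f * c.
Proof. by rewrite [RHS]mulr_suml; apply: eq_bigr => p _; rewrite mulrA. Qed.

Lemma kernel_sumZl x f c : kernel_sum x (fun y => c * f y) = c * kernel_sum x f.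
Proof. by rewrite [RHS]mulr_sumr; apply: eq_bigr => p _; rewrite mulrCA. Qed.

Lemma kernel_sum_exchange x y f :
  kernel_sum x (fun x' => kernel_sum y (f x')) = kernel_sum y (fun y' => kernel_sum x (fun x' => f x' y')).
Proof.
rewrite /kernel_sum; under eq_bigr do rewrite mulr_sumr.
rewrite exchange_big; apply: eq_bigr => p _; rewrite mulr_sumr.
by apply: eq_bigr => q _; rewrite mulrCA.
Qed.

Lemma kernel_convZB F F' c s :
  kernel_conv (fun u => c * F u - F' u) s = c * kernel_conv F s - kernel_conv F' s.
Proof.
elim: s F F' => //= x s IH F F'; rewrite -kernel_sumZl -kernel_sumB; apply: eq_kernel_sum => y.
exact: IH.
Qed.

Lemma contr_kernel_sum A x y (G : I -> seq I -> R) s :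
  contr A x (fun u => kernel_sum y (fun y' => G y' u)) s = kernel_sum y (fun y' => contr A x (G y') s).
Proof.
rewrite /kernel_sum contr_sum; apply: eq_bigr => p _; exact: contrZ.
Qed.

(** Multilinearity of one expansion step.  It goes through by induction because the
    sums over the replacements of [x] and of the next index commute. *)
Lemma kernel_conv_contr A x F s :
  kernel_sum x (fun x' => kernel_conv (contr A x' F) s) = contr (kernel_mx A) x (kernel_conv F) s.
Proof.
elim: s F => [|y t IH] F /=.
  by rewrite /kernel_sum big1 // => p _; rewrite mulr0.
rewrite contr_kernel_sum /kernel_mx -kernel_sumZr.
under eq_kernel_sum => x' do (under eq_kernel_sum => y' do rewrite kernel_convZB; rewrite kernel_sumB kernel_sumZr).
rewrite kernel_sumB kernel_sumZr; congr (_ - _); rewrite ?kernel_sumZr //.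
by rewrite kernel_sum_exchange; apply: eq_kernel_sum => y'; apply: IH.
Qed.

Lemma kernel_conv_seq_pf A m s : kernel_conv (seq_pf A m) s = seq_pf (kernel_mx A) m s.
Proof.
elim: m s => [|m IH] [|x s] //=.
  by rewrite /kernel_sum big1 // => p _; rewrite (_ : kernel_conv _ s = 0) ?mulr0 //;
    elim: s p => //= y s IHs p; rewrite /kernel_sum big1 // => q _; rewrite IHs ?mulr0.
rewrite kernel_conv_contr; apply: contr_ext => u; exact: IH.
Qed.
End Kernel.

(** * Convolution operators on alternating functions *)

Section Convolution.
Variable R : comUnitRingType.
Implicit Types (g : nat -> R) (F : seq nat -> R) (s t : seq nat).

Fixpoint conv g F s : R :=
  if s is a :: t then
    \sum_(0 <= b < a.+1) g (a - b)%N * conv g (fun u => F (b :: u)) t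
  else F [::].

(** The indices of the block matrix are of two kinds: [inl a] for a part of the outer
    partition, which is lowered, and [inr m] for a part of the inner one, which
    stays. *)
Definition step_kernel g (x : nat + nat) : seq (R * (nat + nat)) :=
  match x with
  | inl a => [seq (g (a - b)%N, inl b) | b <- index_iota 0 a.+1]
  | inr m => [:: (1, inr m)]
  end.

Lemma kernel_sum_inl g a f :
  kernel_sum (step_kernel g) (inl a) f = \sum_(0 <= b < a.+1) g (a - b)%N * f (inl b).
Proof. by rewrite /kernel_sum /step_kernel big_map. Qed.

Lemma kernel_sum_inr g m f : kernel_sum (step_kernel g) (inr m) f = f (inr m).
Proof. by rewrite /kernel_sum /step_kernel big_seq1 mul1r. Qed.

Lemma conv_ext g F F' s : F =1 F' -> conv g F s = conv g F' s.
Proof. by elim: s F F' => //= a s IH F F' eF; apply: eq_bigr => b _; congr (_ * _); apply: IH. Qed.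

Definition joint (a r : seq nat) : seq (nat + nat) := map inl a ++ map inr r.

Lemma kernel_conv_joint g (F : seq (nat + nat) -> R) a r :
  kernel_conv (step_kernel g) F (joint a r) = conv g (fun b => F (joint b r)) a.
Proof.
elim: a F => [|x a IH] F /=; last by rewrite kernel_sum_inl; apply: eq_bigr => b _; rewrite IH.
rewrite /joint /=; elim: r F => //= m r IH F; rewrite kernel_sum_inr; exact: IH.
Qed.

Lemma convN g F s : conv g (fun u => - F u) s = - conv g F s.
Proof.
elim: s F => //= a s IH F; rewrite -sumrN; apply: eq_bigr => b _; rewrite -mulrN; congr (_ * _).
exact: IH.
Qed.

Lemma conv0 g s : conv g (fun=> 0) s = 0.
Proof. by elim: s => //= a s IH; rewrite big1 // => b _; rewrite IH mulr0. Qed.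

Definition alternating F :=
  (forall a b, swaps a b F) /\ (forall a, kills a F).

Lemma alternating_cons a F : alternating F -> alternating (fun u => F (a :: u)).
Proof. by case=> sF kF; split=> [b c|b] s t; [apply: (sF b c (a :: s))|apply: (kF b (a :: s))]. Qed.

(** The terms (i, j) and (j, i) cancel; the induction avoids a division by 2. *)
Lemma sum_alternating (r : seq nat) (f : nat -> nat -> R) :
  (forall i j, f i j = - f j i) -> (forall i, f i i = 0) ->
  \sum_(i <- r) \sum_(j <- r) f i j = 0.
Proof.
move=> fN f0; elim: r => [|x r IH]; first by rewrite big_nil.
rewrite big_cons big_cons f0 add0r.
under [X in _ + X]eq_bigr => i _ do rewrite big_cons fN.
by rewrite big_split /= IH addr0 sumrN subrr.
Qed.

Lemma alternating_conv g F : alternating F -> alternating (conv g F).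
Proof.
move=> altF; split=> [a b|a] s t.
  elim: s F altF => [|c s IH] F altF /=; last first.
    rewrite -sumrN; apply: eq_bigr => d _; rewrite -mulrN; congr (_ * _).
    by apply: IH; apply: alternating_cons.
  under eq_bigr do rewrite mulr_sumr.
  rewrite exchange_big -sumrN; apply: eq_bigr => i _.
  rewrite mulr_sumr -sumrN; apply: eq_bigr => j _.
  rewrite mulrCA -!mulrN -convN; do 2!congr (_ * _); apply: conv_ext => u.
  by have [sF _] := altF; rewrite -(sF _ _ [::]).
elim: s F altF => [|c s IH] F altF /=; last first.
  by apply: big1 => d _; rewrite IH ?mulr0 //; apply: alternating_cons.
under eq_bigr do rewrite mulr_sumr.
apply: sum_alternating => [i j|i].
  rewrite mulrCA -!mulrN -convN; do 2!congr (_ * _); apply: conv_ext => u.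
  by have [sF _] := altF; rewrite -(sF _ _ [::]).
rewrite (@conv_ext _ _ (fun=> 0)) ?conv0 ?mulr0 // => u.
by have [_ kF] := altF; apply: (kF _ [::]).
Qed.

Fixpoint below s : seq (seq nat) :=
  if s is a :: t then [seq b :: u | b <- index_iota 0 a.+1, u <- below t] else [:: [::]].

Fixpoint step_weight g s u : R :=
  match s, u with a :: s', b :: u' => g (a - b)%N * step_weight g s' u' | _, _ => 1 end.

Lemma big_below a s (P : pred (seq nat)) (G : seq nat -> R) :
  \sum_(u <- below (a :: s) | P u) G u
  = \sum_(0 <= b < a.+1) \sum_(u <- below s | P (b :: u)) G (b :: u).
Proof.
rewrite big_mkcond /below -/below big_allpairs_dep; apply: eq_bigr => b _.
by rewrite [RHS]big_mkcond.
Qed.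

Lemma conv_below g F s : conv g F s = \sum_(u <- below s) step_weight g s u * F u.
Proof.
elim: s F => [|a s IH] F; first by rewrite /= big_seq1 mul1r.
rewrite big_below /=; apply: eq_bigr => b _; rewrite IH mulr_sumr.
by apply: eq_bigr => u _; rewrite mulrA.
Qed.

Lemma belowP s u :
  reflect (size u = size s /\ forall i, nth 0 u i <= nth 0 s i)%N (u \in below s).
Proof.
elim: s u => [|a s IH] u.
  rewrite inE; apply: (iffP eqP) => [->|[/eqP/nilP]] //.
apply: (iffP allpairsP) => [[[b v] /=]|].
  rewrite mem_index_iota ltnS => -[/andP[_ ba] /IH[sv le] ->] /=; rewrite sv; split=> // -[|i] //=.
case: u => [|b v] /= [] // [sv] le; exists (b, v) => /=; split => //.
  by rewrite mem_index_iota ltnS (le 0%N).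
by apply/IH; split => // i; apply: (le i.+1).
Qed.

Lemma uniq_below s : uniq (below s).
Proof.
elim: s => // a s IH; apply: allpairs_uniq => //; first exact: iota_uniq.
by move=> [b u] [c v] _ _ /= [-> ->].
Qed.

Definition e_step y r : R := match r with 0 => 1 | 1 => y | _ => 0 end.
Definition h_step y r : R := y ^+ r.

(** Strips of shifted diagrams, for strict [la] and [ka] of the same length with
    [ka] contained in [la]: two cells of row i and row i+1 share a column iff
    la_(i+1) >= ka_i, because each row starts one column further right. *)
Fixpoint hstrip la ka : bool :=
  match la, ka with
  | a :: s, c :: t => (if s is b :: _ then (b < c)%N else true) && hstrip s t
  | _, _ => true
  end.
Fixpoint vstrip la ka : bool :=
  match la, ka with
  | a :: s, c :: t => (a <= c.+1)%N && vstrip s t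
  | _, _ => true
  end.

Lemma hstripP la ka : size ka = size la ->
  reflect (forall i, (i.+1 < size la)%N -> (nth 0 la i.+1 < nth 0 ka i)%N)
    (hstrip la ka).
Proof.
elim: la ka => [|a la IH] [|c ka] //= => [_|[] /IH{}IH]; first by left.
case: la IH => [|b la] /= IH; first by left => -[].
apply: (iffP andP) => [[bc /IH h] [|i] //|h]; first exact: (h i).
by split; [apply: (h 0%N)|apply/IH => i; apply: (h i.+1)].
Qed.

Lemma vstripP la ka : size ka = size la ->
  reflect (forall i, (nth 0 la i <= (nth 0 ka i).+1)%N) (vstrip la ka).
Proof.
elim: la ka => [|a la IH] [|c ka] //= => [_|[] /IH{}IH].
  by left => i; rewrite nth_nil.
apply: (iffP andP) => [[bc /IH h] [|i]|h]; [exact: bc|exact: h|].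
by split; [apply: (h 0%N)|apply/IH => i; apply: (h i.+1)].
Qed.

Lemma hstrip_sorted la ka : ka \in below la -> hstrip la ka -> sorted gtn ka.
Proof.
move=> /belowP[sz le] /(hstripP sz) h; apply/sorted_gtnP => i si.
by apply: leq_ltn_trans (h i _); rewrite -?sz.
Qed.

(** Row operations.  In the first position, the part of the sum with c <= b, where
    [b] is the second entry of [la], is y^(a-b) times what the second position
    contributes, so that it vanishes by alternation.  What remains is b < c <= a,
    which is the strip condition. *)
Lemma conv_h y F la : alternating F -> sorted gtn la ->
  conv (h_step y) F la = \sum_(ka <- below la | hstrip la ka) step_weight (h_step y) la ka * F ka.
Proof.
elim: la F => [|a la IH] F altF; first by rewrite /= big_seq1 mul1r.
move=> sla; have sla' := path_sorted sla; rewrite big_below /=.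
have step (r : seq nat) : \sum_(b <- r) h_step y (a - b) * conv (h_step y) (fun u => F (b :: u)) la
   = \sum_(b <- r) \sum_(u <- below la | hstrip la u)
       h_step y (a - b) * step_weight (h_step y) la u * F (b :: u).
  apply: eq_bigr => b _; rewrite IH //; last exact: alternating_cons.
  by rewrite mulr_sumr; apply: eq_bigr => u _; rewrite mulrA.
case: la IH sla sla' step => [|b la] IH sla sla' step; first exact: step.
have ba : (b < a)%N by case/andP: sla.
have io f : \sum_(0 <= c < a.+1) f c = \sum_(0 <= c < b.+1) f c + \sum_(b.+1 <= c < a.+1) f c :> R.
  by rewrite -big_cat_nat // ltnW.
(* the terms with b < c are those of the strips; the others vanish *)
rewrite !io; congr (_ + _); last first.
  rewrite step; apply: eq_big_seq => c; rewrite mem_index_iota => /andP[bc _].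
  by apply: eq_bigl => u; rewrite bc.
rewrite [RHS]big1_seq => [|c]; last first.
  rewrite mem_index_iota ltnS /= => cb.
  by rewrite big_pred0 // => u; rewrite ltnNge cb.
have hs c : (c <= b)%N -> h_step y (a - c) = h_step y (a - b) * h_step y (b - c).
  by move=> cb; rewrite /h_step -exprD addnBA // subnK // ltnW.
under eq_big_seq => c.
  rewrite mem_index_iota ltnS => /andP[_ cb]; rewrite (hs c cb) -mulrA mulr_sumr.
  over.
rewrite -mulr_sumr sum_alternating ?mulr0 // => [i j|i]; rewrite -/conv.
  rewrite mulrCA -!mulrN -convN; do 2!congr (_ * _); apply: conv_ext => u.
  by have [sF _] := altF; rewrite -(sF _ _ [::]).
rewrite (@conv_ext _ _ (fun=> 0)) ?conv0 ?mulr0 // => u.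
by have [_ kF] := altF; apply: (kF _ [::]).
Qed.

Lemma step_weight_e y la ka : ka \in below la ->
  step_weight (e_step y) la ka = if vstrip la ka then step_weight (h_step y) la ka else 0.
Proof.
elim: la ka => [|a la IH] [|c ka] // /belowP[] //= [sz] le.
rewrite IH; last by apply/belowP; split => // i; apply: (le i.+1).
have := le 0%N; rewrite /= => ca.
have -> : (a <= c.+1)%N = (a - c <= 1)%N by rewrite leq_subLR addn1.
case: (a - c)%N => [|[|d]] /=; rewrite ?mul0r // ?mul1r; case: ifP; rewrite ?mulr0 //.
Qed.

(** Lowering the entries of a strict sequence by at most one keeps it weakly
    decreasing, so that a sequence which is no longer strict has two equal adjacent
    entries. *)
Lemma unsorted_vstrip la ka F : alternating F -> sorted gtn la -> ka \in below la ->
  vstrip la ka -> ~~ sorted gtn ka -> F ka = 0.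
Proof.
move=> altF sla /belowP[sz le] /(vstripP sz) vs nk.
have [i si nlt] := unsorted_step nk.
have e : nth 0%N ka i.+1 = nth 0%N ka i.
  apply/eqP; rewrite eqn_leq nlt andbT.
  move/sorted_gtnP: sla => /(_ i); rewrite -sz => /(_ si) lt.
  by rewrite -ltnS (leq_trans _ (vs i)) // (leq_ltn_trans (le i.+1)).
have [_ kF] := altF; move: (kF (nth 0%N ka i) (take i ka) (drop i.+2 ka)).
by rewrite -{2}e -!drop_nth ?cat_take_drop // ltnW.
Qed.

Definition letter_step (p : bool) y := if p then e_step y else h_step y.
Definition strip (p : bool) := if p then vstrip else hstrip.

(** The transfer of one letter of weight [y], primed iff [p], is a convolution. *)
Lemma conv_letter_step p y F la : alternating F -> sorted gtn la ->
  conv (letter_step p y) F la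
  = \sum_(ka <- below la | sorted gtn ka && strip p la ka) step_weight (h_step y) la ka * F ka.
Proof.
move=> altF sla; case: p; rewrite /letter_step /strip.
  rewrite conv_below [RHS]big_mkcond; apply: eq_big_seq => ka kala /=.
  rewrite step_weight_e //; case: ifP => vs; rewrite ?mul0r ?andbF //.
  rewrite andbT; case: ifPn => // nk.
  by rewrite (unsorted_vstrip altF sla kala vs nk) mulr0.
rewrite conv_h // big_seq_cond [RHS]big_seq_cond; apply: eq_bigl => ka.
by case: (boolP (ka \in _)) => // kala; case: (boolP (hstrip _ _)) => [/(hstrip_sorted kala) ->|]; rewrite ?andbF.
Qed.

Definition convs (gs : seq (nat -> R)) F : seq nat -> R := foldr conv F gs.

Lemma alternating_convs gs F : alternating F -> alternating (convs gs F).
Proof. by move=> altF; elim: gs => //= g gs; apply: alternating_conv. Qed.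

Lemma below_trans s t u : t \in below s -> u \in below t -> u \in below s.
Proof.
move=> /belowP[st lt] /belowP[tu lu]; apply/belowP; split; first by rewrite tu.
by move=> i; apply: leq_trans (lu i) (lt i).
Qed.

Definition convs_mx (gs : seq (nat -> R)) (A : nat + nat -> nat + nat -> R) :=
  foldr (fun g => kernel_mx (step_kernel g)) A gs.

Lemma convs_seq_pf gs A m r s :
  convs gs (fun u => seq_pf A m (joint u r)) s = seq_pf (convs_mx gs A) m (joint s r).
Proof.
elim: gs s => //= g gs IH s; rewrite (conv_ext g s IH) -kernel_conv_joint; exact: kernel_conv_seq_pf.
Qed.

(** A function of one or two naturals, extended by 0 to sequences of other lengths;
    this makes one-row and two-row shapes instances of the general recursion. *)
Definition rowF (f : nat -> R) (s : seq nat) := if s is [:: a] then f a else 0.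
Definition pairF (f : nat -> nat -> R) (s : seq nat) := if s is [:: a; b] then f a b else 0.

Lemma convs_mx_ll gs A a b :
  convs_mx gs A (inl a) (inl b) = convs gs (pairF (fun a b => A (inl a) (inl b))) [:: a; b].
Proof.
elim: gs a b => //= g gs IH a b; rewrite /kernel_mx kernel_sum_inl; apply: eq_bigr => a' _.
by rewrite kernel_sum_inl; congr (_ * _); apply: eq_bigr => b' _; rewrite IH.
Qed.

Lemma convs_mx_lr gs A a m :
  convs_mx gs A (inl a) (inr m) = convs gs (rowF (fun a => A (inl a) (inr m))) [:: a].
Proof.
elim: gs a => //= g gs IH a; rewrite /kernel_mx kernel_sum_inl; apply: eq_bigr => a' _.
by rewrite kernel_sum_inr IH.
Qed.

Lemma convs_mx_rr gs A l m : convs_mx gs A (inr l) (inr m) = A (inr l) (inr m).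
Proof. by elim: gs => //= g gs IH; rewrite /kernel_mx !kernel_sum_inr. Qed.

Definition shift_by m (f : nat -> R) a := if (m <= a)%N then f (a - m)%N else 0.

(** Convolution commutes with translation: a row [a] with its first [m] cells
    removed behaves like the row [a - m]. *)
Lemma conv_shift_by g m F F' a :
  (forall a, F [:: a] = shift_by m (fun b => F' [:: b]) a) ->
  conv g F [:: a] = shift_by m (fun b => conv g F' [:: b]) a.
Proof.
move=> eF /=; rewrite /shift_by; case: leqP => ma; last first.
  apply: big1_seq => b; rewrite mem_index_iota ltnS => /andP[_ ba].
  by rewrite eF /shift_by leqNgt (leq_ltn_trans ba ma) mulr0.
rewrite (@big_cat_nat _ _ _ m) //=; last exact: leqW.
rewrite big1_seq ?add0r => [|b].
  rewrite -{1}[m]add0n big_addn subSn //; apply: eq_bigr => b _.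
  by rewrite eF /shift_by leq_addl addnK subnDA subnAC.
by rewrite mem_index_iota /= => bm; rewrite eF /shift_by leqNgt bm mulr0.
Qed.

Lemma convs_shift_by gs m f a :
  convs gs (rowF (shift_by m f)) [:: a] = shift_by m (fun b => convs gs (rowF f) [:: b]) a.
Proof. by elim: gs a => //= g gs IH a; apply: conv_shift_by. Qed.

(** The entries of the block matrix, from the values [zr] for one row and [zp] for
    two rows. *)
Definition pf_entry (zr : nat -> R) (zp : nat -> nat -> R) (x y : nat + nat) : R :=
  match x, y with
  | inl a, inl b => zp a b
  | inl a, inr m => shift_by m zr a
  | inr m, inl a => - shift_by m zr a
  | inr _, inr _ => 0
  end.

Lemma alternating_seq_pf zr zp m r :
  (forall a b, zp a b = - zp b a) -> (forall a, zp a a = 0) ->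
  alternating (fun u => seq_pf (pf_entry zr zp) m (joint u r)).
Proof.
move=> zpN zp0; split=> [a b|a] s t; rewrite /joint !map_cat /= -!catA /=.
  exact: (@swaps_seq_pf _ _ (pf_entry zr zp) (inl a) (inl b) m (zpN a b)).
exact: (@kills_seq_pf _ _ (pf_entry zr zp) (inl a) m (zp0 a)).
Qed.

Lemma alternating_rowF f : alternating (rowF f).
Proof. by split=> [a b|a] [|x [|y s]] t; rewrite /= ?oppr0. Qed.

Lemma alternating_pairF f :
  (forall a b, f a b = - f b a) -> (forall a, f a a = 0) -> alternating (pairF f).
Proof.
move=> fN f0; split=> [a b|a] [|x [|y [|z s]]] [|w t]; rewrite /= ?oppr0 //.
Qed.

(** If the one-row and two-row data are related by convolution, so are the
    Pfaffians.  As [la] is strict and positive, the relation for two rows is used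
    for a > b > 0 only; it fails for b = 0, where the pair (0, 0) would count. *)
Lemma seq_pf_step W gs zr zp zr' zp' m la r :
  (forall a, (a <= W)%N -> zr' a = convs gs (rowF zr) [:: a]) ->
  (forall a b, (0 < b < a)%N -> (a <= W)%N -> zp' a b = convs gs (pairF zp) [:: a; b]) ->
  sorted gtn la -> 0%N \notin la -> all (leq^~ W) la ->
  convs gs (fun u => seq_pf (pf_entry zr zp) m (joint u r)) la
  = seq_pf (pf_entry zr' zp') m (joint la r).
Proof.
move=> hr hp sla la0 /allP laW; rewrite convs_seq_pf; apply: eq_seq_pf.
rewrite /joint pairwise_cat; apply/and3P; split.
- apply/allrelP => _ _ /mapP[a /laW aW ->] /mapP[l _ ->].
  rewrite convs_mx_lr /= convs_shift_by /shift_by; case: leqP => // la'.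
  by rewrite hr // (leq_trans (leq_subr _ _)).
- rewrite pairwise_map.
  move: sla; rewrite (sorted_pairwise gtn_trans).
  apply: (sub_in_pairwise (P := mem la)) => [a b ala bla /= ba|]; last exact/allP.
  by rewrite convs_mx_ll hp ?laW // ba lt0n andbT; apply: contraNneq la0 => <-.
- by rewrite pairwise_map; elim: (r) => //= a s ->; rewrite andbT; apply/allP => b _; apply/eqP; exact: convs_mx_rr.
Qed.

Section Zeros.
Variables (zr : nat -> R) (zp : nat -> nat -> R).
Hypotheses (zr0 : zr 0%N = 1) (zp0 : forall a, (0 < a)%N -> zp a 0%N = zr a).
Let A := pf_entry zr zp.

(** The two indices [inl 0] and [inr 0] have the same matrix entries with all the
    others: a substitution of indices turns one into the other. *)
Lemma seq_pf_move_zero m la r : 0%N \notin la -> 0%N \notin r ->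
  seq_pf A m (joint (rcons la 0%N) r) = seq_pf A m (joint la (0%N :: r)).
Proof.
move=> la0 r0; pose f (x : nat + nat) := if x == inr 0%N then inl 0%N else x.
have fr b : b \in r -> f (inr b) = inr b.
  by rewrite /f => br; case: eqP => // -[b0]; rewrite -b0 br in r0.
have -> : joint (rcons la 0%N) r = map f (joint la (0%N :: r)).
  rewrite /joint map_cat /= map_rcons cat_rcons -!map_comp; congr (_ ++ _ :: _).
  by apply/eq_in_map => b /= br; rewrite fr.
rewrite seq_pf_map; apply: eq_seq_pf; rewrite /joint pairwise_cat.
apply/and3P; split.
- apply/allrelP => _ y /mapP[a ala ->]; rewrite inE => /orP[/eqP ->|/mapP[b /fr fb ->]].
    rewrite /f /= zp0 /shift_by ?subn0 // lt0n; by apply: contraNneq la0 => <-.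
  by rewrite fb.
- by rewrite pairwise_map; elim: (la) => //= a s ->; rewrite andbT; apply/allP => b _ /=.
- rewrite /=; apply/andP; split.
    apply/allP => _ /mapP[b br ->]; rewrite fr //= /shift_by leqn0.
    by case: (b =P 0%N) => // b0; rewrite b0 (negbTE r0) in br.
  rewrite pairwise_map; apply: (sub_in_pairwise (P := mem r) (r := fun _ _ => true)).
  - by move=> a b ar br _ /=; rewrite !fr.
  - exact/allP.
  - by elim: (r) => //= a s ->; rewrite andbT; apply/allP => b _ /=.
Qed.

(** Expansion along [x] in the presence of both zeros: the terms removing one of the
    two cancel, since they come with opposite signs. *)
Lemma contr_zero_pair x (F F' : seq (nat + nat) -> R) la r :
  A x (inl 0%N) = A x (inr 0%N) ->
  (forall u t, all (leq 1) u -> all (leq 1) t ->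
     F (joint (rcons u 0%N) t) = F (joint u (0%N :: t))) ->
  (forall u t, all (leq 1) u -> all (leq 1) t ->
     F (joint (rcons u 0%N) (0%N :: t)) = F' (joint u t)) ->
  all (leq 1) la -> all (leq 1) r ->
  contr A x F (joint (rcons la 0%N) (0%N :: r)) = contr A x F' (joint la r).
Proof.
move=> Ax; elim: la F F' => [|a la IH] F F' mv F00 /=.
  move=> _ r1; rewrite Ax (mv [::] r) // opprB addrCA subrr addr0 /joint /=.
  apply: contr_eq_in => // u /subseqP[k _ ->]; rewrite -map_mask.
  apply: (F00 [::]) => //; apply/allP => b /mem_mask; exact/allP.
case/andP=> a1 la1 r1; rewrite /joint /= -!/(joint _ _) F00 //; congr (_ - _).
apply: IH => // u t u1 t1; first by apply: (mv (a :: u)); rewrite /= ?a1.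
by apply: (F00 (a :: u)); rewrite /= ?a1.
Qed.

(** Subtracting one of the equal rows from the other isolates their common entry
    [zr 0 = 1]. *)
Lemma seq_pf_cancel_zeros m la r : 0%N \notin la -> 0%N \notin r ->
  seq_pf A m.+1 (joint (rcons la 0%N) (0%N :: r)) = seq_pf A m (joint la r).
Proof.
have pos s : (0%N \notin s) = all (leq 1) s.
  by elim: s => //= a s <-; rewrite inE negb_or; case: a.
elim: m la r => [|m IH] [|a la] r; rewrite !pos => la1 r1.
1, 3: rewrite /joint /= /shift_by subnn zr0 mul1r contr_row0 ?subr0 // => y /mapP[b br ->];
  by rewrite /= /shift_by leqNgt (allP r1 b br).
all: move: la1 => /= /andP[]; case: a => // a _ la1.
all: have Ax : A (inl a.+1) (inl 0%N) = A (inl a.+1) (inr 0%N)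
  by rewrite /= zp0 // /shift_by subn0.
- apply: (etrans (@contr_zero_pair (inl a.+1) (seq_pf A 0) (fun=> 0) la r Ax _ _ la1 r1)).
  + by move=> [|? ?] [|? ?].
  + by move=> [|? ?] [|? ?].
  + exact: contr0.
apply: (@contr_zero_pair (inl a.+1) (seq_pf A m.+1) (seq_pf A m) la r Ax _ _ la1 r1) => u t u1 t1.
- by apply: seq_pf_move_zero; rewrite pos.
- by apply: IH; rewrite pos.
Qed.
End Zeros.

(** Here the block of two outer parts vanishes and an outer part [a] has the only
    nonzero entry 1, with the inner part [a].  The inner parts come in reverse
    order, so the pairs are nested and the sign is +1. *)
Lemma seq_pf_base m la mu (zr := fun a => (a == 0%N)%:R) (zp := fun _ _ => 0) :
  sorted gtn la -> sorted gtn mu -> (m.*2 = size la + size mu)%N ->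
  seq_pf (pf_entry zr zp) m (joint la (rev mu)) = (la == mu)%:R.
Proof.
elim: m la mu => [|m IH] [|a la] mu // sla smu.
- by case: mu smu.
- rewrite add0n => sz; have: size (rev mu) = m.+1.*2 by rewrite size_rev.
  have -> : ([::] == mu) = false by case: mu {smu} sz.
  by case: (rev mu) => // b t _; rewrite /joint /= contr_row0 // => y /mapP[c _ ->].
rewrite doubleS /= addSn => -[sz].
have Aab b : pf_entry zr zp (inl a) (inr b) = (a == b)%:R.
  rewrite /= /shift_by /zr; case: leqP => [ba|ab]; last by rewrite ltn_eqF.
  by rewrite subn_eq0 [in RHS]eqn_leq ba andbT.
have [amu|namu] := boolP (a \in mu); last first.
  rewrite contr_row0 => [|y]; first by rewrite (_ : _ == mu = false) //;
    apply: contraNF namu => /eqP <-; rewrite mem_head.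
  rewrite mem_cat => /orP[] /mapP[b bs ->] //; rewrite Aab; case: eqP => // ab.
  by rewrite ab -mem_rev bs in namu.
case/splitPr: amu smu sz => mu1 mu2 smu sz.
have um : uniq (mu1 ++ a :: mu2) by apply: sorted_uniq smu => [|x]; [exact: gtn_trans|rewrite /= ltnn].
have namu : a \notin mu1 ++ mu2.
  by move: um; rewrite uniq_catC /= !mem_cat orbC => /andP[].
rewrite rev_cat rev_cons -cats1 -catA !map_cat catA /= -/(joint la (rev mu2)).
(* the only nonzero entry of the first row is the one at the inner part a *)
rewrite contr_row1; last first.
  move=> y; rewrite -catA -map_cat mem_cat => /orP[] /mapP[b bs ->] //; rewrite Aab.
  case: eqP => // ab; case/negP: namu; rewrite mem_cat; move: bs.
  by rewrite mem_cat !mem_rev orbC ab.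
rewrite Aab eqxx mulr1 /joint -catA -map_cat -rev_cat -/(joint _ _) IH; first last.
- by apply: eq_add_S; rewrite sz !size_cat /= !addnS.
- apply: subseq_sorted smu; first exact: gtn_trans.
  by rewrite subseq_cat2l subseq_cons.
- exact: path_sorted sla.
rewrite size_cat !size_map size_rev.
case: mu1 {namu um} smu sz => [|b mu1] smu sz.
  rewrite /= eqseq_cons eqxx /=; case: eqP sz => [-> sz|]; last by rewrite mulr0.
  by rewrite mulr1 addnn -signr_odd odd_double.
move: smu; rewrite cat_cons sorted_gtn_cons all_cat /= => /andP[/and3P[_ ab _] _].
rewrite eqseq_cons (ltn_eqF ab) /=; case: eqP sla => [->|]; last by rewrite mulr0.
by rewrite sorted_gtn_cons /= ltnNge ltnW.
Qed.
End Convolution.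

(** * Fillings given by pairwise conditions *)

Section Tab.
Variables (R : comUnitRingType) (X Y : finType) (w : Y -> R).
Implicit Types (C : X -> X -> Y -> Y -> bool) (P : pred Y) (D U : {set X}).
Implicit Types (T : {ffun X -> option Y}).

(** A filling of [D] is a function on the ambient type, equal to [None] exactly
    outside [D], so that fillings of different sets have the same type.  All the
    conditions on tableaux compare two cells and their entries; they are gathered
    in one relation [C]. *)
Definition fills P D T : bool :=
  [forall c, if T c is Some a then (c \in D) && P a else c \notin D].

Definition compat C T : bool :=
  [forall c, forall d, if T c is Some a then if T d is Some b then C c d a b else true else true].

Definition fill_weight T : R := \prod_c (if T c is Some a then w a else 1).

Definition tab_sum C P D : R := \sum_(T | fills P D T && compat C T) fill_weight T.

Lemma fillsP P D T :
  reflect (forall c, if T c is Some a then (c \in D) /\ P a else c \notin D) (fills P D T).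
Proof.
apply: (iffP forallP) => h c; move: (h c); case: (T c) => // a; first by move/andP.
by case=> -> ->.
Qed.

Lemma compatP C T :
  reflect (forall c d a b, T c = Some a -> T d = Some b -> C c d a b) (compat C T).
Proof.
apply: (iffP forallP) => h c; first by move=> d a b Tc Td; move/forallP: (h c) => /(_ d); rewrite Tc Td.
apply/forallP => d; case Tc: (T c) => [a|] //; case Td: (T d) => [b|] //; exact: h.
Qed.

Lemma fills_some P D T c : fills P D T -> c \in D -> exists2 a, T c = Some a & P a.
Proof.
move=> /fillsP /(_ c); case: (T c) => [a [_ Pa] _|/negP //]; by exists a.
Qed.

Lemma eq_tab_sum C P P' D : P =1 P' -> tab_sum C P D = tab_sum C P' D.
Proof.
move=> eP; apply: eq_bigl => T; congr (_ && _); apply: eq_forallb => c.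
by case: (T c) => // a; rewrite eP.
Qed.

(** Cutting an alphabet in two: if a compatible pair of a letter of [P1] and a letter
    of [P2] constrains only the positions of the two cells, a filling is the choice
    of the set [U] of cells with letters in [P1] together with two independent
    fillings. *)
Lemma tab_sum_split C P1 P2 (cross : rel X) D :
  (forall a, P1 a -> ~~ P2 a) ->
  (forall c d a b, P1 a -> P2 b -> c != d -> C c d a b && C d c b a = cross c d) ->
  tab_sum C (predU P1 P2) D
  = \sum_(U : {set X} | (U \subset D) &&
           [forall c in U, forall d in D :\: U, cross c d])
      tab_sum C P1 U * tab_sum C P2 (D :\: U).
Proof.
move=> P12 Ccross.
pose lo T := [set c | if T c is Some a then P1 a else false].
rewrite /tab_sum.
under [RHS]eq_bigr => U _ do rewrite big_distrlr /= pair_big.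
rewrite pair_big_dep /=.
pose glue (p : {set X} * ({ffun X -> option Y} * {ffun X -> option Y})) :=
  [ffun c => if c \in p.1 then p.2.1 c else p.2.2 c].
pose cut T := (lo T, ([ffun c => if c \in lo T then T c else None],
                      [ffun c => if c \in lo T then None else T c])).
(* cut and glue are mutually inverse on the fillings that satisfy the conditions *)
symmetry; rewrite (reindex_onto cut glue) /=; last first.
  move=> [U [T1 T2]] /= /and3P[/andP[UD _] /andP[/fillsP f1 _] /andP[/fillsP f2 _]].
  have loU : lo (glue (U, (T1, T2))) = U.
    apply/setP => c; rewrite !inE ffunE /=; case: ifPn => cU.
      by move: (f1 c); case: (T1 c) => [a []|/negP].
    move: (f2 c); case: (T2 c) => [a [_ P2a]|] //.
    by apply/negP => /P12; rewrite P2a.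
  rewrite /cut loU; congr (_, (_, _)); apply/ffunP => c; rewrite !ffunE /=.
    by case: (boolP (c \in U)) => // cU; move: (f1 c); case: (T1 c) => // a []; rewrite (negbTE cU).
  by case: (boolP (c \in U)) => // cU; move: (f2 c); case: (T2 c) => // a []; rewrite inE cU.
have glueK T : glue (cut T) = T.
  by apply/ffunP => c; rewrite !ffunE /=; case: (c \in lo T).
apply: eq_big => [T|T _]; last first.
  rewrite /fill_weight -big_split /=; apply: eq_bigr => c _; rewrite !ffunE.
  by case: ifP; rewrite ?mulr1 ?mul1r.
rewrite glueK eqxx andbT.
have inlo c a : T c = Some a -> (c \in lo T) = P1 a by rewrite inE => ->.
apply/idP/idP.
  move=> /and3P[/andP[/subsetP UD X12] /andP[/fillsP f1 /compatP c1] /andP[/fillsP f2 /compatP c2]].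
  have f c a : T c = Some a -> c \in D /\ (P1 a || P2 a).
    move=> Tc; move: (f1 c) (f2 c); rewrite !ffunE (inlo c a Tc) Tc.
    case: (boolP (P1 a)) => [P1a _ _|_ _ []]; first by rewrite UD ?(inlo _ _ Tc).
    by rewrite in_setD => /andP[_ ->] ->.
  apply/andP; split.
    apply/fillsP => c; case Tc: (T c) => [a|]; first exact: f.
    apply/negP => cD; move: (f1 c) (f2 c); rewrite !ffunE Tc if_same => cl.
    by rewrite in_setD cl cD.
  have c12 c d a b : T c = Some a -> T d = Some b -> P1 a -> ~~ P1 b -> C c d a b && C d c b a.
    move=> Tc Td P1a nP1b; have [dD] := f d b Td; rewrite (negbTE nP1b) /= => P2b.
    have cl : c \in lo T by rewrite (inlo _ _ Tc).
    have dl : d \notin lo T by rewrite (inlo _ _ Td).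
    rewrite Ccross //; last by apply: contraTneq cl => ->.
    by move/forall_inP: X12 => /(_ c cl) /forall_inP /(_ d); apply; rewrite in_setD dl.
  apply/compatP => c d a b Tc Td.
  have [P1a|P1a] := boolP (P1 a); have [P1b|P1b] := boolP (P1 b).
  - by apply: c1; rewrite ffunE ?(inlo _ _ Tc) ?(inlo _ _ Td) ?P1a ?P1b.
  - by case/andP: (c12 c d a b Tc Td P1a P1b).
  - by case/andP: (c12 d c b a Td Tc P1b P1a).
  - by apply: c2; rewrite ffunE ?(inlo _ _ Tc) ?(inlo _ _ Td) ?(negbTE P1a) ?(negbTE P1b).
move=> /andP[/fillsP f /compatP cT].
have fS c a : T c = Some a -> c \in D /\ (P1 a || P2 a) by move=> Tc; move: (f c); rewrite Tc.
have loT c : c \in lo T -> exists2 a, T c = Some a & P1 a.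
  by rewrite inE; case: (T c) => // a P1a; exists a.
apply/and3P; split; apply/andP; split.
- by apply/subsetP => c /loT[a /fS[]].
- apply/forall_inP => c cl; apply/forall_inP => d; rewrite in_setD => /andP[dl dD].
  have [a Tc P1a] := loT c cl; move: (f d); case Td: (T d) => [b|]; last by rewrite dD.
  move=> [_ /=]; rewrite -(inlo _ _ Td) (negbTE dl) /= => P2b.
  rewrite -(Ccross c d a b) //; last by apply: contraTneq cl => ->.
  by rewrite !cT.
- apply/fillsP => c; rewrite ffunE; case: ifPn => // cl.
  by have [a Tc P1a] := loT c cl; rewrite Tc.
- apply/compatP => c d a b; rewrite !ffunE; do 2!case: ifP => // _; exact: cT.
- apply/fillsP => c; rewrite ffunE in_setD; case: ifPn => //= cl.
  move: (f c); case Tc: (T c) => [a|] //= -[-> P12a]; split => //.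
  by move: P12a; rewrite -(inlo _ _ Tc) (negbTE cl).
- apply/compatP => c d a b; rewrite !ffunE; do 2!case: ifP => // _; exact: cT.
Qed.

Lemma tab_sum_pred0 C D : tab_sum C pred0 D = (D == set0)%:R.
Proof.
rewrite /tab_sum (eq_bigl (fun T => (D == set0) && (T == [ffun=> None]))); last first.
  move=> T; apply/idP/idP.
    move=> /andP[/fillsP f _]; apply/andP; split.
      by apply/set0Pn => -[c cD]; move: (f c); case: (T c) => [a []|]; rewrite ?cD.
    by apply/eqP/ffunP => c; rewrite ffunE; move: (f c); case: (T c) => // a [].
  move=> /andP[/eqP -> /eqP ->]; apply/andP; split.
    by apply/fillsP => c; rewrite ffunE inE.
  by apply/compatP => c d a b; rewrite ffunE.
case: eqP => _; last by rewrite big_pred0.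
by rewrite big_pred1_eq /fill_weight big1 // => c _; rewrite ffunE.
Qed.

Lemma tab_sum_pred1 C a D :
  tab_sum C (pred1 a) D
  = if [forall c in D, forall d in D, C c d a a] then w a ^+ #|D| else 0.
Proof.
pose T0 := [ffun c => if c \in D then Some a else None].
rewrite /tab_sum (eq_bigl (fun T => [forall c in D, forall d in D, C c d a a] && (T == T0))); last first.
  move=> T; apply/idP/idP.
    move=> /andP[/fillsP f /compatP cT].
    have TE : T = T0.
      apply/ffunP => c; rewrite ffunE; move: (f c); case: (T c) => [b [-> /eqP ->]|/negbTE ->] //.
    rewrite TE eqxx andbT; apply/forall_inP => c cD; apply/forall_inP => d dD.
    by apply: cT; rewrite TE ffunE ?cD ?dD.
  move=> /andP[cD /eqP ->]; apply/andP; split.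
    by apply/fillsP => c; rewrite ffunE; case: ifPn => //= cDc; rewrite eqxx.
  apply/compatP => c d b e; rewrite !ffunE; case: ifP => // cD' [<-]; case: ifP => // dD [<-].
  by move/forall_inP: cD => /(_ c cD') /forall_inP; apply.
case: ifP => _; last by rewrite big_pred0.
rewrite big_pred1_eq /fill_weight -prodr_const [RHS]big_mkcond; apply: eq_bigr => c _.
by rewrite ffunE; case: ifP.
Qed.

Lemma eq_tab_sum_compat C C' P D :
  (forall c d a b, c \in D -> d \in D -> P a -> P b -> C c d a b = C' c d a b) ->
  tab_sum C P D = tab_sum C' P D.
Proof.
move=> eC; apply: eq_bigl => T; case: (boolP (fills P D T)) => // /fillsP f.
have fS c a : T c = Some a -> c \in D /\ P a by move=> Tc; move: (f c); rewrite Tc.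
by apply/compatP/compatP => cT c d a b Tc Td; have [? ?] := fS _ _ Tc;
  have [? ?] := fS _ _ Td; move: (cT c d a b Tc Td); rewrite eC.
Qed.
End Tab.

(** * Shifted diagrams and their ideals *)

(** Strict partitions with any number of trailing zeros. *)
Definition strict_part (la : seq nat) := sorted (fun a b => (b < a)%N || (b == 0)%N) la.
Definition contained (mu la : seq nat) :=
  all (fun i => nth 0 mu i <= nth 0 la i)%N (iota 0 (size mu)).

Lemma containedP mu la : reflect (contains la mu) (contained mu la).
Proof.
apply: (iffP allP) => [h i|h i _]; last exact: h.
case: (ltnP i (size mu)) => im; first by apply: h; rewrite mem_iota.
by rewrite nth_default.
Qed.

Lemma contained_trans : transitive contained.
Proof.
by move=> b a c /containedP ab /containedP bc; apply/containedP => i; apply: leq_trans (ab i) (bc i).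
Qed.

Lemma below_contained la ka : ka \in below la -> contained ka la.
Proof. by move/belowP => [_ h]; apply/containedP. Qed.

Lemma strict_partP la :
  reflect (forall i, (0 < nth 0 la i.+1 -> nth 0 la i.+1 < nth 0 la i)%N) (strict_part la).
Proof.
apply: (iffP (sortedP 0%N)) => h i.
  case: (ltnP i.+1 (size la)) => si; last by rewrite nth_default.
  by move: (h i si) => /orP[//|/eqP ->].
by move=> _; move: (h i); case: (nth 0%N la i.+1) => [|a]; rewrite ?eqxx ?orbT // => ->.
Qed.

Lemma strict_part_mono la : strict_part la ->
  forall i j, (i <= j)%N -> (0 < nth 0 la j)%N -> (j + nth 0 la j <= i + nth 0 la i)%N.
Proof.
move=> /strict_partP sla i j ij; rewrite -(subnK ij); elim: (j - i)%N => // d IH.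
rewrite addSn => p; have lt := sla _ p.
apply: leq_trans (IH _); last exact: leq_ltn_trans lt.
by rewrite addSn -addnS leq_add2l.
Qed.

Lemma sorted_strict_part la : sorted gtn la -> strict_part la.
Proof. by apply: sub_sorted => a b /= ->. Qed.

(** A left-closed set of cells in a row is described by its size. *)
Lemma count_closed (p : pred nat) N :
  (forall t, (t.+1 < N)%N -> p t.+1 -> p t) ->
  forall t, (t < N)%N -> p t = (t < count p (iota 0 N))%N.
Proof.
elim: N => // N IH h t; have -> : iota 0 N.+1 = iota 0 N ++ [:: N] by rewrite -[N.+1]addn1 iotaD.
rewrite count_cat /= addn0 ltnS => tN.
have h' u : (u.+1 < N)%N -> p u.+1 -> p u by move=> uN; apply: h; exact: leqW.
have [pN|npN] := boolP (p N); last first.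
  rewrite addn0; move: tN; rewrite leq_eqVlt => /orP[/eqP ->|tN]; last exact: IH.
  rewrite (negbTE npN); apply/esym/negbTE; rewrite -leqNgt.
  by rewrite -[X in (_ <= X)%N](size_iota 0) count_size.
have all_p u : (u <= N)%N -> p (N - u)%N.
  elim: u => [|u IHu] uN; first by rewrite subn0.
  by apply: h; rewrite -subSn // subSS ?IHu ?ltnS ?leq_subr // ltnW.
have pt u : (u <= N)%N -> p u by move=> uN; rewrite -(subKn uN) all_p // leq_subr.
rewrite pt // (_ : count p _ = N) ?addn1 ?ltnS //.
rewrite -[RHS](size_iota 0); apply/eqP; rewrite -all_count; apply/allP => u.
by rewrite mem_iota => /= uN; rewrite pt // ltnW.
Qed.

Section Grid.
Variable W : nat.
Let X := ('I_W.+1 * 'I_W.+1)%type.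

Definition shifted_cells (la : seq nat) : {set X} :=
  [set c : X | (c.1 <= c.2 < c.1 + nth 0 la c.1)%N].
Definition skew_cells la mu := shifted_cells la :\: shifted_cells mu.
(** The diagrams are drawn in a finite grid; this ensures that the one of [la] is not
    truncated. *)
Definition fits (la : seq nat) := forall i, (0 < nth 0 la i -> i + nth 0 la i <= W)%N.
Definition grid_cell (i j : nat) : X := (inord i, inord j).
Definition cross (c d : X) :=
  ~~ ((d.1 == c.1) && (d.2 <= c.2)%N) && ~~ ((d.2 == c.2) && (d.1 <= c.1)%N).

Lemma fits_contained la ka : contained ka la -> fits la -> fits ka.
Proof.
move=> /containedP h fla i p; apply: leq_trans (fla i (leq_trans p (h i))).
by rewrite leq_add2l.
Qed.

Lemma mem_grid_cell la i j : (i <= W)%N -> (j <= W)%N ->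
  (grid_cell i j \in shifted_cells la) = (i <= j < i + nth 0 la i)%N.
Proof. by move=> iW jW; rewrite inE /= !inordK. Qed.

Lemma fits_bound la i t : fits la -> (t < nth 0 la i)%N -> (i + t < W)%N.
Proof.
move=> fla tl; apply: leq_trans (fla i (leq_ltn_trans (leq0n _) tl)).
by rewrite ltn_add2l.
Qed.

Lemma mem_grid_cell_fits la ka i t : fits la -> (t < nth 0 la i)%N ->
  (grid_cell i (i + t) \in shifted_cells ka) = (t < nth 0 ka i)%N.
Proof.
move=> fla tl; have b := fits_bound fla tl.
by rewrite mem_grid_cell ?leq_addr ?ltn_add2l // ltnW // (leq_ltn_trans (leq_addr _ _) b).
Qed.

Lemma grid_cellK (c : X) : (c.1 <= c.2)%N -> grid_cell c.1 (c.1 + (c.2 - c.1)) = c.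
Proof. by move=> le; rewrite subnKC // /grid_cell !inord_val; case: c {le}. Qed.

Lemma sub_shifted_cells la ka : contained ka la -> shifted_cells ka \subset shifted_cells la.
Proof.
move=> /containedP h; apply/subsetP => c; rewrite !inE => /andP[-> lt] /=.
by apply: leq_trans lt _; rewrite leq_add2l.
Qed.

Lemma shifted_cells_sub la ka : fits ka -> shifted_cells ka \subset shifted_cells la -> contained ka la.
Proof.
move=> fka /subsetP h; apply/containedP => i.
case e: (nth 0%N ka i) => [|a] //; have ai : (a < nth 0 ka i)%N by rewrite e.
have := h (grid_cell i (i + a)); rewrite (mem_grid_cell_fits ka fka ai) (mem_grid_cell_fits la fka ai).
exact.
Qed.

(** The row lengths of the union of [U] and the diagram of [mu] give the partition.
    The absence of forbidden pairs in a row makes each row left-closed, and in a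
    column it makes the row lengths strictly decrease. *)
Lemma ideal_shape la mu (U : {set X}) :
  fits la -> strict_part la -> strict_part mu -> contained mu la -> U \subset skew_cells la mu ->
  [forall c in U, forall d in skew_cells la mu :\: U, cross c d] ->
  exists ka, [/\ ka \in below la, strict_part ka, contained mu ka & U = skew_cells ka mu].
Proof.
move=> fla sla smu mula UD Xc.
have UDP c : c \in U -> (c \in shifted_cells la) && (c \notin shifted_cells mu).
  by move/(subsetP UD); rewrite inE andbC.
have crossP c d : c \in U -> d \in shifted_cells la -> d \notin shifted_cells mu -> d \notin U -> cross c d.
  move=> cU dl dm dU; move/forall_inP: Xc => /(_ c cU) /forall_inP; apply.
  by rewrite !in_setD dU dm.
pose V := U :|: shifted_cells mu.
have VS c : c \in V -> c \in shifted_cells la.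
  rewrite in_setU => /orP[/UDP /andP[]|] //; exact: (subsetP (sub_shifted_cells mula)).
pose ka := mkseq (fun i => count (fun t => grid_cell i (i + t) \in V) (iota 0 (nth 0%N la i))) (size la).
have kaE i : nth 0%N ka i = count (fun t => grid_cell i (i + t) \in V) (iota 0 (nth 0%N la i)).
  case: (ltnP i (size la)) => il; first by rewrite nth_mkseq.
  by rewrite !nth_default // size_mkseq.
have kale i : (nth 0 ka i <= nth 0 la i)%N.
  by rewrite kaE -[X in (_ <= X)%N](size_iota 0) count_size.
have kala : ka \in below la by apply/belowP; rewrite size_mkseq.
have closed i t : (t.+1 < nth 0 la i)%N -> grid_cell i (i + t.+1) \in V -> grid_cell i (i + t) \in V.
  move=> tl; have tl' := ltnW tl; rewrite !in_setU.
  have [_|nmu] := boolP (grid_cell i (i + t) \in shifted_cells mu); first by rewrite !orbT.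
  rewrite (mem_grid_cell_fits mu fla tl).
  have nmu' : (t.+1 < nth 0 mu i)%N = false.
    by apply/negbTE; apply: contra nmu => lt; rewrite (mem_grid_cell_fits mu fla tl') ltnW.
  rewrite nmu' !orbF => cU; apply: contraT => nU.
  have := crossP _ _ cU _ nmu nU; rewrite (mem_grid_cell_fits la fla tl') => /(_ tl').
  have b := fits_bound fla tl.
  have b' := fits_bound fla tl'.
  by rewrite /cross eqxx /= !inordK ?leq_add2l ?leqnSn // ltnS ?(ltnW b) ?(ltnW b') // (leq_trans (leq_addr _ _) (ltnW b)).
have SV : shifted_cells ka = V.
  apply/setP => c; case: (boolP (c \in shifted_cells la)) => cla; last first.
    rewrite (negbTE (contra (@VS c) cla)); apply/negbTE.
    by apply: contra cla; apply: (subsetP (sub_shifted_cells (below_contained kala))).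
  have /andP[le lt] : (c.1 <= c.2 < c.1 + nth 0 la c.1)%N by move: cla; rewrite inE.
  have tl : (c.2 - c.1 < nth 0 la c.1)%N by rewrite ltn_subLR.
  rewrite -(grid_cellK le) (mem_grid_cell_fits ka fla tl) kaE.
  by rewrite -(@count_closed (fun t => grid_cell c.1 (c.1 + t) \in V)) // => t; apply: closed.
exists ka; split => //.
- apply/strict_partP => i; case e: (nth 0%N ka i.+1) => [|a] // _.
  have ai : (a < nth 0 ka i.+1)%N by rewrite e.
  have fka := fits_contained (below_contained kala) fla.
  have al : (a < nth 0 la i.+1)%N by apply: leq_trans (kale _).
  have al' : (a.+1 < nth 0 la i)%N.
    by apply: (leq_ltn_trans al); move/strict_partP: sla; apply; apply: leq_ltn_trans al.
  rewrite -(mem_grid_cell_fits ka fla al') SV in_setU.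
  have : grid_cell i.+1 (i.+1 + a) \in V by rewrite -SV (mem_grid_cell_fits ka fka ai).
  rewrite in_setU; have [_|nmu] := boolP (grid_cell i (i + a.+1) \in shifted_cells mu); first by rewrite orbT.
  rewrite (mem_grid_cell_fits mu fla al) orbF => /orP[cU|am]; last first.
    case/negP: nmu; rewrite (mem_grid_cell_fits mu fla al').
    by apply: (leq_ltn_trans am); move/strict_partP: smu; apply; apply: leq_ltn_trans am.
  apply: contraT => nU; have := crossP _ _ cU _ nmu nU.
  rewrite (mem_grid_cell_fits la fla al') => /(_ al'); rewrite /cross addSnnS eqxx /=.
  have b := fits_bound fla al; have b1 : (i.+1 <= W)%N by apply: leq_trans (leq_addr _ _) (ltnW b).
  by rewrite !inordK ?leqnSn ?andbF // ltnS ?(ltnW b1) // -addSnnS ltnW.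
- apply: shifted_cells_sub; first exact: fits_contained mula fla.
  by rewrite SV subsetUr.
- rewrite /skew_cells SV setDUl setDv setU0; apply/setP => c; rewrite in_setD andbC.
  by case: (boolP (c \in U)) => // /UDP /andP[_ ->].
Qed.

Lemma shape_ideal la mu ka :
  strict_part ka -> contained mu ka -> contained ka la ->
  skew_cells ka mu \subset skew_cells la mu /\ [forall c in skew_cells ka mu, forall d in skew_cells la mu :\: skew_cells ka mu, cross c d].
Proof.
move=> ska muka kala; split; first exact: setSD (sub_shifted_cells kala).
apply/forall_inP => c; rewrite in_setD => /andP[_ cka].
apply/forall_inP => d; rewrite !in_setD => /andP[nd /andP[dm dla]].
have {nd dm} dka : d \notin shifted_cells ka by move: nd; rewrite dm.
have d12 : (d.1 <= d.2)%N by move: dla; rewrite inE => /andP[].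
rewrite /cross; apply/andP; split; apply: contra dka => /andP[/eqP e le].
  move: cka; rewrite !inE d12 -e /= => /andP[_]; exact: (leq_ltn_trans le).
move: cka; rewrite !inE d12 /= e => /andP[cc lt].
apply: (leq_trans lt (strict_part_mono ska le _)).
by rewrite -(ltn_add2l c.1) addn0 (leq_ltn_trans cc lt).
Qed.

Lemma skew_cellsD la ka mu : contained mu ka -> skew_cells la mu :\: skew_cells ka mu = skew_cells la ka.
Proof.
move=> /sub_shifted_cells /subsetP h; apply/setP => c; rewrite !in_setD.
by case: (boolP (c \in shifted_cells mu)) => [/h ->|].
Qed.

(** The sets of cells that can carry the smaller letters of a tableau are the skew
    diagrams of intermediate strict partitions. *)
Lemma sum_ideals (R : comUnitRingType) la mu (f : {set X} -> {set X} -> R) :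
  fits la -> strict_part la -> strict_part mu -> contained mu la ->
  \sum_(U : {set X} | (U \subset skew_cells la mu) && [forall c in U, forall d in skew_cells la mu :\: U, cross c d])
     f U (skew_cells la mu :\: U)
  = \sum_(ka <- below la | strict_part ka && contained mu ka) f (skew_cells ka mu) (skew_cells la ka).
Proof.
move=> fla sla smu mula.
pose ks := [seq ka <- below la | strict_part ka && contained mu ka].
transitivity (\sum_(U <- [seq skew_cells ka mu | ka <- ks]) f U (skew_cells la mu :\: U)); last first.
  rewrite big_map big_filter; apply: eq_bigr => ka /andP[_ muka].
  by rewrite skew_cellsD.
rewrite big_uniq /=; last first.
  rewrite map_inj_in_uniq ?filter_uniq ?uniq_below // => a b.
  rewrite !mem_filter => /andP[/andP[_ ma] al] /andP[/andP[_ mb] bl] eD.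
  have SE c : contained mu c -> shifted_cells c = skew_cells c mu :|: shifted_cells mu.
    by move=> /sub_shifted_cells h; rewrite /skew_cells setUC setDE setUIr setUCr setIT (setUidPr h).
  have eS : shifted_cells a = shifted_cells b by rewrite (SE a) // (SE b) // eD.
  have fa := fits_contained (below_contained al) fla.
  have fb := fits_contained (below_contained bl) fla.
  have /containedP ab : contained a b by apply: shifted_cells_sub; rewrite // eS.
  have /containedP ba : contained b a by apply: shifted_cells_sub; rewrite // eS.
  move: al bl => /belowP[sa _] /belowP[sb _].
  apply: (@eq_from_nth _ 0%N) => [|i _]; first by rewrite sa.
  by apply/eqP; rewrite eqn_leq ab ba.
apply: eq_bigl => U; apply/idP/mapP.
  case/andP => UD Xc; have [ka [kl sk mk ->]] := ideal_shape fla sla smu mula UD Xc.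
  by exists ka => //; rewrite mem_filter sk mk.
case=> ka; rewrite mem_filter => /andP[/andP[sk mk] kl] ->.
by apply/andP; apply: shape_ideal => //; apply: below_contained.
Qed.
End Grid.

(** * The letters of one value *)

Lemma sorted_gtn_strict_part nu ka : sorted gtn nu -> size nu = size ka ->
  strict_part ka -> contained nu ka -> sorted gtn ka.
Proof.
move=> /sorted_gtnP snu sz /strict_partP ska /containedP h; apply/sorted_gtnP => i si.
case e: (nth 0%N ka i.+1) => [|a]; last by rewrite -e ska // e.
apply: leq_trans (h i); apply: leq_ltn_trans (snu i _); by rewrite ?sz.
Qed.

Lemma step_weight_sum (R : comUnitRingType) (y : R) la ka : size ka = size la ->
  step_weight (h_step y) la ka = y ^+ \sum_(i < size la) (nth 0 la i - nth 0 ka i)%N.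
Proof.
elim: la ka => [|a la IH] [|b ka] //=; first by rewrite big_ord0 expr0.
by case=> sz; rewrite big_ord_recl IH // exprD.
Qed.

Lemma sum_support (F : nat -> nat) N M :
  (forall i, (N <= i)%N -> F i = 0%N) -> (forall i, (M <= i)%N -> F i = 0%N) ->
  (\sum_(i < N) F i = \sum_(i < M) F i)%N.
Proof.
wlog NM : N M / (N <= M)%N.
  move=> letter_weight hN hM; case: (leqP N M) => [|/ltnW] NM; first exact: letter_weight.
  by apply/esym/letter_weight.
move=> hN _; rewrite (big_ord_widen M F NM) big_mkcond; apply: eq_bigr => i _.
by case: ltnP => // /hN ->.
Qed.

Section Cells.
Variable W : nat.
Local Notation X := ('I_W.+1 * 'I_W.+1)%type.

Lemma card_skew_cells la ka : fits W la -> size ka = size la ->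
  #|skew_cells W la ka| = (\sum_(i < size la) (nth 0 la i - nth 0 ka i))%N.
Proof.
move=> fla sz; rewrite (@sum_support (fun i => nth 0 la i - nth 0 ka i)%N _ W.+1) /=; first last.
- move=> i Wi; case e: (nth 0%N la i) => [|a] //.
  have := fla i; rewrite e => /(_ isT); rewrite leqNgt => /negP[]; rewrite addnS ltnS.
  by rewrite ltnW // (leq_trans Wi) // leq_addr.
- by move=> i li; rewrite nth_default.
transitivity (\sum_(i < W.+1) \sum_(j < W.+1 | (i, j) \in skew_cells W la ka) 1)%N.
  rewrite pair_big_dep -sum1_card /=; apply: eq_bigl => -[i j] //.
apply: eq_bigr => i _; rewrite sum1_card.
transitivity (size (iota (i + nth 0 ka i) (nth 0 la i - nth 0 ka i)))%N; last by rewrite size_iota.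
rewrite cardE -(size_map val); apply: perm_size; apply: uniq_perm.
- by rewrite map_inj_uniq ?enum_uniq //; apply: val_inj.
- exact: iota_uniq.
have DE (j : 'I_W.+1) : ((i, j) \in skew_cells W la ka) = (i + nth 0 ka i <= j < i + nth 0 la i)%N.
  by rewrite /skew_cells in_setD !inE /=; lia.
move=> j; rewrite mem_iota; apply/mapP/idP => [[j']|].
  by rewrite mem_enum => h ->; have: (i, j') \in skew_cells W la ka := h; rewrite DE /=; lia.
move=> h; have jW : (j < W.+1)%N by have := fla i; lia.
exists (Ordinal jW) => //; rewrite mem_enum.
by suff: (i, Ordinal jW) \in skew_cells W la ka by []; rewrite DE /=; lia.
Qed.
End Cells.

Section Letters.
Variables (R : comUnitRingType) (n : nat) (W : nat) (w : letter n -> R).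
Local Notation X := ('I_W.+1 * 'I_W.+1)%type.
Implicit Types (c d : X) (a b : letter n).

(** The conditions on rows and columns.  The one on the diagonal is kept apart, since
    within a single value it concerns the shape alone. *)
Definition tab_rel c d a b :=
  [&& ((c.1 == d.1) && (c.2 <= d.2)%N) ==> (rank a <= rank b)%N,
      ((c.2 == d.2) && (c.1 <= d.1)%N) ==> (rank a <= rank b)%N,
      [&& c != d, c.1 == d.1 & primed a] ==> (a != b)
    & [&& c != d, c.2 == d.2 & ~~ primed a] ==> (a != b)].

Lemma tab_rel_cross c d a b : (rank a < rank b)%N ->
  tab_rel c d a b && tab_rel d c b a = cross c d.
Proof.
move=> ab; have nab : a != b by apply: contraTneq ab => ->; rewrite ltnn.
by rewrite /tab_rel (ltnW ab) nab [b == a]eq_sym nab !implybT (leqNgt (rank b)) ab /=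
  !implybF !andbT.
Qed.

Lemma tab_rel_same c d a :
  tab_rel c d a a = ~~ [&& c != d, c.1 == d.1 & primed a] && ~~ [&& c != d, c.2 == d.2 & ~~ primed a].
Proof. by rewrite /tab_rel leqnn !implybT eqxx /= !implybF. Qed.

Lemma mem_skew_cells la ka i t : fits W la -> (nth 0 ka i <= t < nth 0 la i)%N ->
  grid_cell W i (i + t) \in skew_cells W la ka.
Proof.
move=> fla /andP[h1 h2].
by rewrite /skew_cells in_setD (mem_grid_cell_fits ka fla h2) (mem_grid_cell_fits la fla h2) h2 -leqNgt h1.
Qed.

(** The cells of [la/ka] can all carry the letter [a] iff they form a strip of the
    direction prescribed by the prime of [a]. *)
Lemma strip_cells a la ka : fits W la -> sorted gtn la -> sorted gtn ka -> ka \in below la ->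
  [forall c in skew_cells W la ka, forall d in skew_cells W la ka, tab_rel c d a a] = strip (primed a) la ka.
Proof.
move=> fla sla ska kala; have /belowP[sz le] := kala.
have DE c : c \in skew_cells W la ka -> (c.1 + nth 0 ka c.1 <= c.2 < c.1 + nth 0 la c.1)%N && (c.1 <= c.2)%N.
  by rewrite /skew_cells in_setD !inE; lia.
apply/idP/idP => [h|].
  have {}h c d : c \in skew_cells W la ka -> d \in skew_cells W la ka -> tab_rel c d a a.
    by move=> cD dD; move/forall_inP: h => /(_ c cD) /forall_inP; apply.
  rewrite /strip; case: ifP => pa.
    apply/(vstripP sz) => i; rewrite leqNgt; apply/negP => lt.
    have b := fits_bound fla lt.
    (* the first two cells of a row of length at least two *)
    have c1 : grid_cell W i (i + nth 0%N ka i) \in skew_cells W la ka by apply: mem_skew_cells => //; lia.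
    have c2 : grid_cell W i (i + (nth 0%N ka i).+1) \in skew_cells W la ka by apply: mem_skew_cells => //; lia.
    have := h _ _ c1 c2; rewrite tab_rel_same pa eqxx /= andbT negbK => /andP[/eqP[/(congr1 val)]].
    by rewrite /= !inordK; lia.
  apply/(hstripP sz) => i il; rewrite ltnNge; apply/negP => lt.
  have := sorted_gtnP la sla i il; have := sorted_gtnP ka ska i; rewrite sz => /(_ il) => h1 h2.
  have b := fits_bound fla h2.
  (* the last cell of row i+1 and the cell above it *)
  have c1 : grid_cell W i (i + nth 0%N la i.+1) \in skew_cells W la ka by apply: mem_skew_cells => //; lia.
  have c2 : grid_cell W i.+1 (i.+1 + (nth 0%N la i.+1).-1) \in skew_cells W la ka by apply: mem_skew_cells => //; lia.
  have e : (i.+1 + (nth 0%N la i.+1).-1 = i + nth 0%N la i.+1)%N by lia.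
  have := h _ _ c1 c2; rewrite tab_rel_same pa e eqxx !andbF /= andbT negbK => /eqP[/(congr1 val)].
  by rewrite /= !inordK; lia.
move=> st; apply/forall_inP => c cD; apply/forall_inP => d dD; rewrite tab_rel_same.
move: (DE c cD) (DE d dD) => hc hd; move: st; rewrite /strip; case: ifP => pa.
  move=> /(vstripP sz) vs; rewrite ?pa /= !andbF !andbT /=; apply/negP => /andP[/negP cd /eqP e]; apply: cd.
  apply/eqP; case: c d e hc hd {cD dD} => [c1 c2] [d1 d2] /= -> hc hd; congr (_, _); apply/val_inj => /=.
  by have := vs d1; lia.
move=> /(hstripP sz) hs; rewrite ?pa /= !andbF !andbT /=; apply/negP => /andP[/negP cd /eqP e]; apply: cd.
have key (i j t : nat) : (i < j)%N -> (i + nth 0 ka i <= t)%N -> (t < j + nth 0 la j)%N -> (j <= t)%N -> False.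
  move=> ij h1 h2 h3; have p : (0 < nth 0 la j)%N by lia.
  have jl : (j < size la)%N by rewrite ltnNge; apply/negP => /(nth_default 0%N) jl; rewrite jl in p.
  have := strict_part_mono (sorted_strict_part sla) ij p.
  by have := hs i (leq_ltn_trans ij jl); lia.
apply/eqP; case: c d e hc hd {cD dD} => [c1 c2] [d1 d2] /= -> hc hd; congr (_, _); apply/val_inj => /=.
case: (ltngtP c1 d1) => // lt.
  by case: (key c1 d1 d2) => //; lia.
by case: (key d1 c1 d2) => //; lia.
Qed.

Lemma step_weight_card (y : R) la ka : fits W la -> ka \in below la ->
  y ^+ #|skew_cells W la ka| = step_weight (h_step y) la ka.
Proof. by move=> fla /belowP[sz _]; rewrite card_skew_cells // step_weight_sum. Qed.

Lemma skew_cells_eq0 la nu : fits W la -> nu \in below la -> (skew_cells W la nu == set0) = (nu == la).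
Proof.
move=> fla nula; apply/eqP/eqP => [D0|->]; last by rewrite /skew_cells setDv.
have /containedP la_nu : contained la nu.
  by apply: (shifted_cells_sub fla); rewrite -setD_eq0 -/(skew_cells W la nu) D0.
have /belowP[sz le] := nula; apply: (@eq_from_nth _ 0%N) => // i _.
by apply/eqP; rewrite eqn_leq le la_nu.
Qed.

Lemma big_below_sub la ka (P : pred (seq nat)) (G : seq nat -> R) : ka \in below la ->
  \sum_(nu <- below la | P nu && (nu \in below ka)) G nu = \sum_(nu <- below ka | P nu) G nu.
Proof.
move=> kala; rewrite big_mkcondl -big_filter [RHS]big_mkcond /=.
apply: perm_big; apply: uniq_perm; rewrite ?filter_uniq ?uniq_below // => nu.
by rewrite mem_filter andb_idr // => /(below_trans kala).
Qed.

(** Letters are listed from the largest down and removed in this order.  The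
    statement concerns all alternating [F] at once, because the convolution for the
    removed letter acts on the convolution for the remaining ones. *)
Lemma sum_letters (ls : seq (letter n)) F la :
  pairwise (fun a b => rank b < rank a)%N ls -> alternating F -> sorted gtn la -> fits W la ->
  \sum_(nu <- below la | sorted gtn nu) tab_sum w tab_rel (mem ls) (skew_cells W la nu) * F nu
  = convs [seq letter_step (primed a) (w a) | a <- ls] F la.
Proof.
elim: ls la => [|a ls IH] la pls altF sla fla.
  rewrite /= big_mkcond (bigD1_seq la) ?uniq_below //=; last by apply/belowP.
  rewrite sla (@eq_tab_sum _ _ _ _ _ _ pred0) // tab_sum_pred0 skew_cells_eq0 //; last by apply/belowP.
  rewrite eqxx mul1r big1_seq ?addr0 // => nu /andP[nla nula].
  by rewrite (@eq_tab_sum _ _ _ _ _ _ pred0) // tab_sum_pred0 skew_cells_eq0 // (negbTE nla) mul0r if_same.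
move: pls => /= /andP[/allP als pls].
rewrite conv_letter_step //; last exact: alternating_convs.
transitivity (\sum_(nu <- below la | sorted gtn nu)
   \sum_(ka <- below la | sorted gtn ka && (nu \in below ka))
     tab_sum w tab_rel (mem ls) (skew_cells W ka nu) * tab_sum w tab_rel (pred1 a) (skew_cells W la ka) * F nu).
  rewrite big_seq_cond [RHS]big_seq_cond; apply: eq_bigr => nu /andP[nula snu].
  rewrite (@eq_tab_sum _ _ _ _ _ _ (predU (mem ls) (pred1 a))); last by move=> b; rewrite /= inE orbC.
  rewrite (@tab_sum_split _ _ _ _ _ _ _ (@cross W)); first last.
  - by move=> c d b _ bls /eqP -> _; apply: tab_rel_cross; apply: als.
  - by move=> b /als lt; apply: contraTneq lt => ->; rewrite ltnn.
  rewrite (@sum_ideals W _ _ _ (fun U V => tab_sum w tab_rel (mem ls) U * tab_sum w tab_rel (pred1 a) V)) //;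
    [|exact: sorted_strict_part|exact: sorted_strict_part|exact: below_contained].
  rewrite mulr_suml big_seq_cond [RHS]big_seq_cond; apply: eq_bigl => ka.
  case: (boolP (ka \in below la)) => //= kala.
  have /belowP[szn _] := nula; have /belowP[szk _] := kala.
  apply/andP/andP => -[h1 h2]; split.
  - by apply: (sorted_gtn_strict_part snu) => //; rewrite szk.
  - by apply/belowP; split; [rewrite szk|apply/containedP].
  - exact: sorted_strict_part.
  - exact: below_contained.
rewrite (exchange_big_dep (fun ka => sorted gtn ka)) /=; last by move=> nu ka _ /andP[].
rewrite big_seq_cond [RHS]big_mkcondr /= [RHS]big_seq_cond; apply: eq_bigr => ka /andP[kala ska].
transitivity (\sum_(nu <- below ka | sorted gtn nu)
   (tab_sum w tab_rel (pred1 a) (skew_cells W la ka) * (tab_sum w tab_rel (mem ls) (skew_cells W ka nu) * F nu))).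
  rewrite -(big_below_sub _ _ kala); apply: eq_big => nu; first by rewrite ska.
  by rewrite -mulrA mulrCA.
rewrite -mulr_sumr IH //; last exact: fits_contained (below_contained kala) fla.
by rewrite tab_sum_pred1 strip_cells // step_weight_card //; case: ifP => _; rewrite ?mul0r.
Qed.
End Letters.

(** * One more value *)

Section Values.
Variables (R : comUnitRingType) (k n : nat) (x : 'I_n -> R) (W : nat).
Local Notation X := ('I_W.+1 * 'I_W.+1)%type.
Implicit Types (c d : X) (a b : letter n).

Definition letter_weight (a : letter n) : R := if barred a then (x (value a))^-1 else x (value a).

Definition diag_rel c d a b :=
  [&& c != d, c.1 == c.2, d.1 == d.2 & (value a < k)%N] ==> (value a != value b).
Definition qtab_rel c d a b := tab_rel c d a b && diag_rel c d a b.

Definition below_value v (a : letter n) : bool :=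
  (value a < v)%N && (barred a ==> (value a < k)%N).
(** From the largest letter down, as [sum_letters] requires. *)
Definition value_letters (v : 'I_n) : seq (letter n) :=
  (if (v < k)%N then [:: (v, true, false); (v, true, true)] else [::])
  ++ [:: (v, false, false); (v, false, true)].
Definition value_steps (v : 'I_n) : seq (nat -> R) :=
  [seq letter_step (primed a) (letter_weight a) | a <- value_letters v].

(** The generating function of the tableaux whose entries take the first [v] values,
    set to 0 if [mu] is not contained in [la]: the recursion sums over all [nu]
    contained in [la], and only those that contain [mu] should count. *)
Definition Qgrid v la mu : R :=
  if contained mu la then tab_sum letter_weight qtab_rel (below_value v) (skew_cells W la mu) else 0.

Lemma mem_value_letters v a :
  (a \in value_letters v) = (value a == v) && (barred a ==> (v < k)%N).
Proof.
case: a => [[u br] p]; rewrite /value_letters /value /barred /=.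
by case: ifP => _; rewrite !inE !xpair_eqE; case: br p => -[]; case: (u == v).
Qed.

Lemma value_letters_desc v : pairwise (fun a b => rank b < rank a)%N (value_letters v).
Proof.
by rewrite /value_letters; case: ifP => _; rewrite /= /rank /value /barred /primed /=; lia.
Qed.

Lemma below_valueS (v : 'I_n) :
  below_value v.+1 =1 predU (below_value v) (mem (value_letters v)).
Proof.
move=> a; rewrite /below_value /= mem_value_letters ltnS leq_eqVlt -val_eqE /=.
by case: ltngtP => [||->] //=; rewrite ?orbF ?andbF.
Qed.

Lemma contained_below_r la mu ka : contained mu ka -> ka \in below la -> contained mu la.
Proof. by move=> h /below_contained; apply: contained_trans. Qed.

(** Three entries at (i,i), (i,i+1), (i+1,i+1) cannot be letters of the same unbarred
    pair: a primed middle entry repeats to the left, an unprimed one below. *)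
Lemma unbarred_clash (v : 'I_n) a b e :
  value a = v -> value b = v -> value e = v -> ~~ barred a -> ~~ barred b -> ~~ barred e ->
  (rank a <= rank b)%N -> (primed a ==> (a != b)) ->
  (rank b <= rank e)%N -> (~~ primed b ==> (b != e)) -> False.
Proof.
case: a b e => [[? ?] p] [[? ?] q] [[? ?] r]; rewrite /rank /value /barred /primed /= => -> -> ->.
move=> /negbTE -> /negbTE -> /negbTE ->; rewrite !leq_add2l.
by case: p q r => [] [] [] //=; rewrite eqxx.
Qed.

(** If the inner shape is a strict sequence of the same length, only the last row can
    start with a cell of the skew diagram. *)
Lemma diag_last la nu (e : X) : size nu = size la -> sorted gtn nu ->
  e.1 = e.2 -> e \in skew_cells W la nu -> (e.1.+1 = size la)%N.
Proof.
move=> szn /sorted_gtnP snu e12; rewrite /skew_cells in_setD !inE -e12 leqnn /= => /andP[h1 h2].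
have nu0 : nth 0%N nu e.1 = 0%N by move: h1; clear; lia.
have el : (e.1 < size la)%N.
  rewrite ltnNge; apply/negP => /(nth_default 0%N) l0; by rewrite l0 addn0 ltnn in h2.
apply/eqP; rewrite eqn_leq el andTb leqNgt; apply/negP => el'.
by have := snu e.1; rewrite szn nu0 ltn0 => /(_ el').
Qed.

(** The inner shapes [nu] with two trailing zeros contribute nothing: their skew
    diagram has two adjacent diagonal cells, which the diagonal condition excludes
    for a value with barred letters and the row and column conditions exclude for
    the others.  On the strict [nu] the diagonal condition is vacuous, and
    [sum_letters] applies. *)
Lemma value_step (v : 'I_n) la mu F :
  sorted gtn la -> 0%N \notin la -> fits W la -> sorted gtn mu -> alternating F ->
  (forall nu, nu \in below la -> sorted gtn nu -> F nu = Qgrid v nu mu) ->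
  Qgrid v.+1 la mu = convs (value_steps v) F la.
Proof.
move=> sla la0 fla smu altF FZ.
rewrite -(sum_letters letter_weight (value_letters_desc v) altF sla fla) /Qgrid.
case: ifP => [mula|/negP nmu]; last first.
  rewrite big1_seq // => nu /andP[snu nula]; rewrite FZ // /Qgrid.
  by case: ifP => [/contained_below_r/(_ nula)/nmu|]; rewrite ?mulr0.
rewrite (eq_tab_sum _ _ _ (below_valueS v)) (@tab_sum_split _ _ _ _ _ _ _ (@cross W)); first last.
- move=> c d a b /andP[av _]; rewrite [mem _ _]mem_value_letters => /andP[/eqP bv _] _.
  have vab : value a != value b by rewrite bv -val_eqE ltn_eqF.
  rewrite /qtab_rel /diag_rel [value b == _]eq_sym vab !implybT !andbT; apply: tab_rel_cross.
  by move: av; rewrite -bv /rank; lia.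
- move=> a /andP[av _]; rewrite [mem _ _]mem_value_letters negb_and -val_eqE ltn_eqF //.
rewrite (@sum_ideals W _ _ _ (fun U V => tab_sum letter_weight qtab_rel (below_value v) U * tab_sum letter_weight qtab_rel (mem (value_letters v)) V)) //;
  try exact: sorted_strict_part.
rewrite big_mkcond [RHS]big_mkcond; apply: eq_big_seq => nu nula.
have /belowP[szn len] := nula.
have posla i : (i < size la)%N -> (0 < nth 0 la i)%N.
  by move=> il; rewrite lt0n; apply: contraNneq la0 => <-; apply: mem_nth.
have [snu|nsnu] := boolP (sorted gtn nu).
  rewrite sorted_strict_part //= FZ // /Qgrid; case: ifP => mn; last by rewrite mulr0.
  rewrite mulrC; congr (_ * _); apply: eq_tab_sum_compat => c d a b cD dD _ _.
  rewrite /qtab_rel; case: (boolP (diag_rel c d a b)); rewrite ?andbT // negb_imply.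
  case/andP => /and4P[cd /eqP c12 /eqP d12 _] _; case/negP: cd.
  have diag (e : X) : e.1 = e.2 -> e \in skew_cells W la nu -> (e.1.+1 = size la)%N.
    exact: diag_last.
  have e1 : c.1 = d.1 by apply/val_inj/eq_add_S; rewrite (diag c) // (diag d).
  by apply/eqP; case: c d e1 c12 d12 {cD dD diag} => c1 c2 [d1 d2] /= -> <- <-.
case: ifP => // /andP[pnu _]; rewrite (_ : tab_sum _ _ _ (skew_cells W la nu) = 0) ?mulr0 //.
have [i [il ni ni1]] : exists i, [/\ (i.+1 < size la)%N, nth 0%N nu i = 0%N & nth 0%N nu i.+1 = 0%N].
  rewrite -szn.
  have [i il nlt] := unsorted_step nsnu.
  by exists i; move/strict_partP: pnu => /(_ i); move: nlt; clear -il => nlt h; split => //; lia.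
(* a tableau would have entries a, b, g at (i,i), (i,i+1), (i+1,i+1) *)
apply: big_pred0 => T; apply/negP => /andP[fT /compatP cT].
have l1 := posla _ il; have := sorted_gtnP la sla i il => l0.
have cD : grid_cell W i i \in skew_cells W la nu by rewrite -[X in grid_cell W _ X]addn0; apply: mem_skew_cells; rewrite // ni leq0n (ltn_trans l1).
have eD : grid_cell W i i.+1 \in skew_cells W la nu by rewrite -[X in grid_cell W _ X]addn1; apply: mem_skew_cells; rewrite // ni (leq_ltn_trans l1).
have dD : grid_cell W i.+1 i.+1 \in skew_cells W la nu by rewrite -[X in grid_cell W _ X]addn0; apply: mem_skew_cells; rewrite // ni1 l1.
have [a Ta] := fills_some fT cD; rewrite [mem _ _]mem_value_letters => /andP[/eqP va ba].
have [b Tb] := fills_some fT eD; rewrite [mem _ _]mem_value_letters => /andP[/eqP vb bb].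
have [g Tg] := fills_some fT dD; rewrite [mem _ _]mem_value_letters => /andP[/eqP vg bg].
have bW := fits_bound fla l1; rewrite addn0 in bW.
have inj p q : (p <= W)%N -> (q <= W)%N -> (inord p == inord q :> 'I_W.+1) = (p == q).
  by move=> pW qW; rewrite -val_eqE /= !inordK.
have i1W := ltnW bW; have iW := ltnW i1W.
have [vk|kv] := boolP (v < k)%N.
  have := cT _ _ _ _ Ta Tg; rewrite /qtab_rel /diag_rel va vg eqxx vk !eqxx /= xpair_eqE !inj //.
  by rewrite ltn_eqF //= andbF.
have := cT _ _ _ _ Ta Tb; have := cT _ _ _ _ Tb Tg.
rewrite /qtab_rel /tab_rel /= !xpair_eqE !inj // eqxx !inordK //=.
move: ba bb bg; rewrite (negbTE kv) !implybF => ba bb bg.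
rewrite ltn_eqF //= !eqxx leqnSn /= => /andP[/andP[r1 p1] _] /andP[/and3P[r2 p2 _] _].
by apply: (unbarred_clash va vb vg).
Qed.
End Values.

(** * Induction on the number of values *)

Section Induction.
Variables (R : comUnitRingType) (k n : nat) (x : 'I_n -> R) (W : nat).
Local Notation X := ('I_W.+1 * 'I_W.+1)%type.
Local Notation Qg v la mu := (Qgrid k x W v la mu).

Definition Qgrid_row v a : R := Qg v [:: a] [::].
Definition Qgrid_pair v a b : R :=
  if (b < a)%N then Qg v [:: a; b] [::]
  else if (a < b)%N then - Qg v [:: b; a] [::] else 0.

Lemma Qgrid_pairN v a b : Qgrid_pair v a b = - Qgrid_pair v b a.
Proof. by rewrite /Qgrid_pair; case: ltngtP; rewrite ?opprK ?oppr0. Qed.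
Lemma Qgrid_pair_diag v a : Qgrid_pair v a a = 0.
Proof. by rewrite /Qgrid_pair ltnn. Qed.

Lemma shifted_ext la la' : nth 0%N la =1 nth 0%N la' -> shifted_cells W la = shifted_cells W la'.
Proof. by move=> e; apply/setP => c; rewrite !inE e. Qed.

Lemma Qgrid_ext v la la' mu mu' :
  nth 0%N la =1 nth 0%N la' -> nth 0%N mu =1 nth 0%N mu' -> Qg v la mu = Qg v la' mu'.
Proof.
move=> el em; rewrite /Qgrid /skew_cells (shifted_ext el) (shifted_ext em).
congr (if _ then _ else _).
by apply/containedP/containedP => h i; move: (h i); rewrite el em.
Qed.

Lemma nth_rcons0 s : nth 0%N (rcons s 0%N) =1 nth 0%N s.
Proof.
move=> i; rewrite nth_rcons; case: ltngtP => // [si|->]; by rewrite nth_default // ltnW.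
Qed.

Lemma tab_sum_set0 (X Y : finType) (w : Y -> R) C P : tab_sum w C P (set0 : {set X}) = 1.
Proof.
rewrite /tab_sum (big_pred1 [ffun=> None]); first by rewrite /fill_weight big1 // => c _; rewrite ffunE.
move=> T; apply/andP/eqP => [[/fillsP f _]|->].
  by apply/ffunP => c; move: (f c); rewrite ffunE; case: (T c) => // a []; rewrite inE.
by split; [apply/fillsP => c; rewrite ffunE inE|apply/compatP => c d a b; rewrite ffunE].
Qed.

Lemma Qgrid_row0 v : Qgrid_row v 0%N = 1.
Proof.
rewrite /Qgrid_row (@Qgrid_ext v _ [::] _ [::]) => [|[|[]]//|//].
by rewrite /Qgrid /= /skew_cells setDv tab_sum_set0.
Qed.

Lemma Qgrid_pair0 v a : (0 < a)%N -> Qgrid_pair v a 0%N = Qgrid_row v a.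
Proof. by move=> a0; rewrite /Qgrid_pair a0; apply: Qgrid_ext => // -[|[|[]]]. Qed.

Lemma convs_0 (v : 'I_n) f : convs (value_steps k x v) (rowF f) [:: 0%N] = f 0%N.
Proof.
rewrite /value_steps; elim: (value_letters k v) => //= a ls IH.
by rewrite big_nat1 IH subnn /letter_step; case: ifP; rewrite /= /h_step ?expr0 mul1r.
Qed.

Lemma fits_strict la : sorted gtn la -> all (leq^~ W) la -> fits W la.
Proof.
move=> sla /allP laW i p.
have il : (i < size la)%N by rewrite ltnNge; apply/negP => /(nth_default 0%N) e; rewrite e in p.
apply: leq_trans (strict_part_mono (sorted_strict_part sla) (leq0n i) p) _.
by apply: laW; apply: mem_nth; case: (size la) il.
Qed.

Lemma Qgrid_row_step (v : 'I_n) a : (a <= W)%N ->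
  Qgrid_row v.+1 a = convs (value_steps k x v) (rowF (Qgrid_row v)) [:: a].
Proof.
case: a => [|a] aW; first by rewrite Qgrid_row0 convs_0 Qgrid_row0.
apply: value_step => //; first by apply: fits_strict; rewrite //= aW.
  exact: alternating_rowF.
by move=> nu /belowP[]; case: nu => [|b []].
Qed.

Lemma Qgrid_pair_step (v : 'I_n) a b : (0 < b < a)%N -> (a <= W)%N ->
  Qgrid_pair v.+1 a b = convs (value_steps k x v) (pairF (Qgrid_pair v)) [:: a; b].
Proof.
move=> /andP[b0 ba] aW; rewrite /Qgrid_pair ba -/(Qgrid_pair _).
apply: value_step => //.
- by rewrite /= ba.
- by rewrite !inE ![0%N == _]eq_sym negb_or -!lt0n b0 (ltn_trans b0).
- by apply: fits_strict; rewrite /= ?ba // aW (leq_trans (ltnW ba)).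
- by apply: alternating_pairF; [apply: Qgrid_pairN|apply: Qgrid_pair_diag].
move=> nu /belowP[]; case: nu => [|c [|d []]] //= _ _; rewrite andbT => dc.
by rewrite /Qgrid_pair dc.
Qed.

(** Without letters only the empty skew diagram can be filled, so [la] and [mu] have
    the same nonzero parts; the parity of the lengths excludes a part 0 of [mu]. *)
Lemma Qgrid_base la mu : sorted gtn la -> 0%N \notin la -> fits W la -> sorted gtn mu ->
  ~~ odd (size la + size mu) -> Qg 0 la mu = (la == mu)%:R.
Proof.
move=> sla la0 fla smu even_sz.
rewrite /Qgrid (@eq_tab_sum _ _ _ _ _ _ pred0) // tab_sum_pred0.
case: (la =P mu) => [->|ne].
  by rewrite /skew_cells setDv eqxx; case: containedP => // -[].
case: ifP => // /containedP mula; case: eqP => // D0; case: ne.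
have lamu : contained la mu by apply: (shifted_cells_sub fla); rewrite -setD_eq0 -/(skew_cells W la mu) D0.
have e i : nth 0%N la i = nth 0%N mu i.
  by apply/eqP; rewrite eqn_leq mula; move/containedP: lamu => ->.
have posla i : (i < size la)%N -> (0 < nth 0 la i)%N.
  by move=> il; rewrite lt0n; apply: contraNneq la0 => <-; apply: mem_nth.
apply: (@eq_from_nth _ 0%N) => // {D0 lamu mula}.
have s1 : (size la <= size mu)%N.
  rewrite leqNgt; apply/negP => lt; have := posla (size mu) lt.
  by rewrite e nth_default.
have s2 : (size mu <= (size la).+1)%N.
  rewrite leqNgt; apply/negP => lt; have := sorted_gtnP mu smu (size la) lt.
  by rewrite -(e (size la)) (nth_default 0%N (leqnn (size la))) ltn0.
apply/eqP; rewrite eqn_leq s1 leqNgt; apply/negP => s3.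
have s4 : size mu = (size la).+1 by apply/eqP; rewrite eqn_leq s2 s3.
by move: even_sz; rewrite s4 addnS addnn /= odd_double.
Qed.

Lemma Qgrid_seq_pf v : (v <= n)%N -> forall la mu m,
  sorted gtn la -> 0%N \notin la -> all (leq^~ W) la -> sorted gtn mu ->
  (m.*2 = size la + size mu)%N ->
  Qg v la mu = seq_pf (pf_entry (Qgrid_row v) (Qgrid_pair v)) m (joint la (rev mu)).
Proof.
elim: v => [|v IH] vn la mu m sla la0 laW smu sz.
  rewrite Qgrid_base //; [|exact: fits_strict|by rewrite -sz odd_double].
  rewrite -(seq_pf_base _ sla smu sz); apply: seq_pf_ext => x1 x2.
  have nz a t : (0 < a)%N -> Qg 0 (a :: t) [::] = 0.
    move=> a0; rewrite /Qgrid /= (@eq_tab_sum _ _ _ _ _ _ pred0) // tab_sum_pred0.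
    rewrite (_ : skew_cells W _ _ == set0 = false) //; apply/negbTE/set0Pn; exists (ord0, ord0).
    by rewrite /skew_cells in_setD !inE /= add0n a0.
  have zr0 a : Qgrid_row 0 a = (a == 0%N)%:R.
    by case: a => [|a]; [rewrite Qgrid_row0|rewrite /Qgrid_row nz].
  have zp0 a b : Qgrid_pair 0 a b = 0.
    rewrite /Qgrid_pair; case: ltngtP => // lt; rewrite nz ?oppr0 //; exact: leq_ltn_trans lt.
  by case: x1 x2 => [a|a] [b|b] //=; rewrite /shift_by ?zp0 ?zr0.
pose v' := Ordinal vn.
have IHn := IH (ltnW vn).
pose F nu := seq_pf (pf_entry (Qgrid_row v) (Qgrid_pair v)) m (joint nu (rev mu)).
have altF : alternating F.
  by apply: alternating_seq_pf; [apply: Qgrid_pairN|apply: Qgrid_pair_diag].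
rewrite (@value_step _ _ _ _ _ v' la mu F) //; first last.
- move=> nu nula snu; have /belowP[szn len] := nula.
  have nuW : all (leq^~ W) nu.
    apply/(all_nthP 0%N) => i inu; apply: leq_trans (len i) _.
    by move/(all_nthP 0%N): laW; apply; rewrite -szn.
  have [nu0|nu0] := boolP (0%N \in nu); last by rewrite (IHn nu mu m) // szn.
  have [nu' [nuE nu'0 snu']] := split_zero snu nu0.
  have nu'W : all (leq^~ W) nu' by move: nuW; rewrite nuE all_rcons => /andP[].
  have sz' : size la = (size nu').+1 by rewrite -szn nuE size_rcons.
  rewrite /F nuE; rewrite nuE in nula.
  (* nu ends in 0: this zero becomes a part of mu, or meets the part 0 of mu *)
  have [mu0|mu0] := boolP (0%N \in mu); last first.
    rewrite seq_pf_move_zero ?mem_rev //; [|exact: Qgrid_pair0].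
    rewrite -rev_rcons -(IHn nu' (rcons mu 0%N)) //; last by rewrite size_rcons sz sz' addSnnS.
      by apply: Qgrid_ext => i; rewrite nth_rcons0.
    rewrite sorted_gtn_rcons smu andbT; apply/allP => b bmu /=; rewrite lt0n; by apply: contraNneq mu0 => <-.
  have [mu' [muE mu'0 smu']] := split_zero smu mu0; rewrite muE rev_rcons.
  case: m sz {F altF} => [|m] sz; first by rewrite sz' in sz.
  rewrite seq_pf_cancel_zeros ?mem_rev //; [|exact: Qgrid_row0|exact: Qgrid_pair0].
  rewrite -(IHn nu' mu') //.
  - by apply: Qgrid_ext => i; rewrite nth_rcons0.
  - by move: sz; rewrite sz' muE size_rcons doubleS addSn addnS => -[].
- exact: fits_strict.
by apply: (seq_pf_step (W := W)) => // [a|a b]; [apply: (Qgrid_row_step v')|apply: (Qgrid_pair_step v')].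
Qed.
End Induction.

(** * Tableaux as fillings of a grid *)

Lemma mem_shifted_diagram la (i j : nat) :
  ((i, j) \in shifted_diagram la) = (i <= j < i + nth 0 la i)%N.
Proof.
apply/allpairsPdep/idP => [[i' [j' [_ h [-> ->]]]]|h]; first by rewrite mem_iota in h.
exists i, j; rewrite !mem_iota; split => //=; rewrite add0n ltnNge; apply/negP => li.
by move: h; rewrite nth_default // addn0; lia.
Qed.

Section Bridge.
Variables (R : comUnitRingType) (k n : nat) (x : 'I_n -> R) (W : nat) (la mu : seq nat).
Local Notation X := ('I_W.+1 * 'I_W.+1)%type.
Local Notation tcell := (Defs.cell la mu).
Hypothesis fla : fits W la.

Definition to_grid (c : tcell) : X := grid_cell W (row_of c) (col_of c).

Lemma cell_bounds (c : tcell) :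
  (row_of c <= col_of c < row_of c + nth 0 la (row_of c))%N
  && ~~ (row_of c <= col_of c < row_of c + nth 0 mu (row_of c))%N.
Proof.
rewrite /row_of /col_of; have := valP c; case: (val c) => i j.
by rewrite mem_filter andbC !mem_shifted_diagram.
Qed.

Lemma cell_le (c : tcell) : (row_of c <= W)%N /\ (col_of c <= W)%N.
Proof. by have := cell_bounds c; have := @fla (row_of c); lia. Qed.

Lemma to_grid1 c : (to_grid c).1 = row_of c :> nat.
Proof. by rewrite /= inordK //; case: (cell_le c). Qed.
Lemma to_grid2 c : (to_grid c).2 = col_of c :> nat.
Proof. by rewrite /= inordK //; case: (cell_le c). Qed.

Lemma to_grid_inj : injective to_grid.
Proof.
move=> c d e; apply/val_inj; move: (congr1 (fun c : X => (c.1 : nat, c.2 : nat)) e).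
by rewrite !to_grid1 !to_grid2 /row_of /col_of; case: (val c) (val d) => [? ?] [? ?].
Qed.

Lemma to_grid_skew_cells c : to_grid c \in skew_cells W la mu.
Proof. by rewrite /skew_cells in_setD !inE !to_grid1 to_grid2 andbC; exact: cell_bounds. Qed.

Lemma skew_cells_to_grid (e : X) : e \in skew_cells W la mu -> exists c, e = to_grid c.
Proof.
rewrite /skew_cells in_setD !inE => /andP[h1 h2].
have h : (e.1 : nat, e.2 : nat) \in skew_diagram la mu.
  by rewrite mem_filter !mem_shifted_diagram h1 h2.
exists (SeqSub h); rewrite /to_grid /grid_cell /row_of /col_of /= !inord_val; by case: e {h h1 h2}.
Qed.

Lemma skew_cells_image : skew_cells W la mu = to_grid @: [set: tcell].
Proof.
apply/setP => e; apply/idP/imsetP => [/skew_cells_to_grid[c ->]|[c _ ->]]; last exact: to_grid_skew_cells.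
by exists c.
Qed.

(** Tableaux live on the type of cells of their own shape; this places them in the
    common grid. *)
Definition extend (T : filling n la mu) : {ffun X -> option (letter n)} :=
  [ffun e => omap T [pick c | to_grid c == e]].

Lemma extendE T c : extend T (to_grid c) = Some (T c).
Proof.
rewrite ffunE; case: pickP => [d /eqP/to_grid_inj -> //|/(_ c)]; by rewrite eqxx.
Qed.

Lemma extend_none T e : e \notin skew_cells W la mu -> extend T e = None.
Proof.
move=> eD; rewrite ffunE; case: pickP => //= c /eqP ec.
by rewrite -ec to_grid_skew_cells in eD.
Qed.

Lemma extend_some T e a : extend T e = Some a -> exists2 c, e = to_grid c & T c = a.
Proof.
rewrite ffunE; case: pickP => //= c /eqP <- [<-]; by exists c.
Qed.

Lemma extend_inj : injective extend.
Proof. by move=> T T' e; apply/ffunP => c; apply/Some_inj; rewrite -!extendE e. Qed.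

Lemma qtab_rel_to_grid c d (a b : letter n) :
  qtab_rel k (to_grid c) (to_grid d) a b
  = [&& ((row_of c == row_of d) && (col_of c <= col_of d)%N) ==> (rank a <= rank b)%N,
        ((col_of c == col_of d) && (row_of c <= row_of d)%N) ==> (rank a <= rank b)%N,
        [&& c != d, row_of c == row_of d & primed a] ==> (a != b),
        [&& c != d, col_of c == col_of d & ~~ primed a] ==> (a != b)
      & [&& c != d, row_of c == col_of c, row_of d == col_of d
      & (value a < k)%N] ==> (value a != value b)].
Proof.
rewrite /qtab_rel /tab_rel /diag_rel (inj_eq to_grid_inj) -!val_eqE /= -!/(to_grid _).
by rewrite !to_grid1 !to_grid2 -!andbA.
Qed.

Lemma qtab_extend (T : filling n la mu) :
  is_qtab k T = fills (below_value k n) (skew_cells W la mu) (extend T) && compat (@qtab_rel k n W) (extend T).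
Proof.
apply/idP/idP.
  case/and5P => al rw cw rp /andP[cu dg]; apply/andP; split.
    apply/fillsP => e; case E: (extend T e) => [a|].
      have [c -> <-] := extend_some E; split; first exact: to_grid_skew_cells.
      by rewrite /below_value ltn_ord; exact: (forallP al c).
    apply/negP => /skew_cells_to_grid[c ec]; by rewrite ec extendE in E.
  apply/compatP => _ _ _ _ /extend_some[c -> <-] /extend_some[d -> <-].
  rewrite qtab_rel_to_grid; apply/and5P; split.
  - exact: (forallP (forallP rw c) d).
  - exact: (forallP (forallP cw c) d).
  - exact: (forallP (forallP rp c) d).
  - exact: (forallP (forallP cu c) d).
  - exact: (forallP (forallP dg c) d).
case/andP => /fillsP f /compatP cT.
have h c d : qtab_rel k (to_grid c) (to_grid d) (T c) (T d) by apply: cT; rewrite extendE.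
rewrite /is_qtab; apply/and5P; split.
- apply/forallP => c; move: (f (to_grid c)); rewrite extendE => -[_]; by case/andP.
- by apply/forallP => c; apply/forallP => d; have := h c d; rewrite qtab_rel_to_grid => /and5P[].
- by apply/forallP => c; apply/forallP => d; have := h c d; rewrite qtab_rel_to_grid => /and5P[].
- by apply/forallP => c; apply/forallP => d; have := h c d; rewrite qtab_rel_to_grid => /and5P[].
apply/andP; split.
  by apply/forallP => c; apply/forallP => d; have := h c d; rewrite qtab_rel_to_grid => /and5P[].
by apply/forallP => c; apply/forallP => d; have := h c d; rewrite qtab_rel_to_grid => /and5P[].
Qed.

Lemma fill_weight_extend (T : filling n la mu) :
  fill_weight (letter_weight x) (extend T) = \prod_c letter_weight x (T c).
Proof.
rewrite /fill_weight (bigID (mem (skew_cells W la mu))) /= [X in _ * X]big1 ?mulr1 => [|e eD]; last first.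
  by rewrite extend_none.
rewrite skew_cells_image big_imset /=; last by move=> c d _ _; apply: to_grid_inj.
by apply: eq_big => [c|c _]; rewrite ?inE ?extendE.
Qed.

(** Grouping the cells by letters.  Invertibility is needed to split the exponents
    of both signs. *)
Lemma weight_prod (T : filling n la mu) :
  (forall i : 'I_n, (i < k)%N -> x i \is a GRing.unit) -> alphabet_cond k T ->
  weight k x T = \prod_c letter_weight x (T c).
Proof.
move=> xu /forallP al.
rewrite (partition_big T predT) //=.
under eq_bigr => a _.
  rewrite (eq_bigr (fun=> letter_weight x a)); last by move=> c /eqP ->.
  rewrite prodr_const.
  over.
rewrite -(pair_bigA _ (fun u p => letter_weight x (u, p) ^+ #|[pred c | T c == (u, p)]|)) /=.
rewrite -(pair_bigA _ (fun i br => \prod_(p : bool) letter_weight x (i, br, p) ^+ #|[pred c | T c == (i, br, p)]|)) /=.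
have mE a : mult T a = #|[pred c | T c == a]| by rewrite /mult cardsE.
rewrite (bigID (fun i : 'I_n => (i < k)%N)) /weight /=; congr (_ * _).
  apply: eq_bigr => i ik; rewrite !big_bool /= /letter_weight /value /barred /= -!mE.
  rewrite !exprzDr ?xu // -!exprz_inv.
  by rewrite -!exprnP [RHS]mulrC !mulrA.
apply: eq_big => i; rewrite -?leqNgt // => ki; rewrite !big_bool /= /letter_weight /value /barred /= -!mE.
have m0 p : mult T (i, true, p) = 0%N.
  rewrite mE; apply: eq_card0 => c; rewrite !inE; apply/negP => /eqP e.
  by have := al c; rewrite e /barred /value /= ltnNge ki.
by rewrite !m0 !expr0 !mul1r exprD.
Qed.

Lemma Qskew_tab_sum : (forall i : 'I_n, (i < k)%N -> x i \is a GRing.unit) ->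
  Qskew k x la mu = tab_sum (letter_weight x) (@qtab_rel k n W) (below_value k n) (skew_cells W la mu).
Proof.
move=> xu; rewrite /tab_sum (eq_bigl (fun T => T \in extend @: [set T | is_qtab k T])); last first.
  move=> T'; apply/idP/imsetP => [ok|[T]]; last by rewrite inE qtab_extend => ok ->.
  have [/fillsP f _] := andP ok.
  have h c : {a | T' (to_grid c) == Some a}.
    case E: (T' (to_grid c)) => [a|]; first by exists a.
    by exfalso; move: (f (to_grid c)); rewrite E to_grid_skew_cells.
  have TE : T' = extend [ffun c => sval (h c)].
    apply/ffunP => e; case: (boolP (e \in skew_cells W la mu)) => eD.
      by have [c ->] := skew_cells_to_grid eD; rewrite extendE ffunE; apply/eqP; exact: (svalP (h c)).
    by rewrite extend_none //; move: (f e); case: (T' e) => // a []; rewrite (negbTE eD).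
  by exists [ffun c => sval (h c)] => //; rewrite inE qtab_extend -TE.
rewrite big_imset /=; last by move=> T T' _ _; apply: extend_inj.
apply: eq_big => [T|T qT]; first by rewrite inE.
by rewrite fill_weight_extend weight_prod //; case/and5P: qT.
Qed.
End Bridge.

Theorem theorem2p3p2 (R : comUnitRingType) (k n : nat) (x : 'I_n -> R)
    (la mu : seq nat)
    (k_le_n : (k <= n)%N)
    (x_unit : forall i : 'I_n, (i < k)%N -> x i \is a GRing.unit)
    (la_strict : sorted gtn la) (la_pos : 0%N \notin la)
    (mu_strict : sorted gtn mu)
    (la_mu : contains la mu)
    (la_size : (2 <= size la)%N)
    (even_size : ~~ odd (size la + size mu)) :
  let M : 'M[R]_(size la) :=
    \matrix_(i, j) Qpair k x (nth 0%N la i) (nth 0%N la j) in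
  let N : 'M[R]_(size la, size mu) :=
    \matrix_(i, j) Qrow k x
      ((nth 0%N la i)%:Z - (nth 0%N mu (size mu - j.+1))%:Z) in
  Qskew k x la mu = pfaffian (block_mx M N (- N^T) 0).
Proof.
move=> M N.
(* the first part bounds all the columns that occur *)
pose W := head 0%N la.
have laW : all (leq^~ W) la.
  move: la_strict; rewrite /W; case: (la) => //= a s.
  rewrite leqnn (path_sortedE gtn_trans) => /andP[/allP h _].
  by apply/allP => b /h /ltnW.
have QZ nu kap : sorted gtn nu -> all (leq^~ W) nu -> contained kap nu ->
    Qskew k x nu kap = Qgrid k x W n nu kap.
  by move=> snu nuW kn; rewrite (@Qskew_tab_sum _ _ _ _ W) ?/Qgrid ?kn //; apply: fits_strict.
rewrite QZ //; last exact/containedP.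
rewrite (@Qgrid_seq_pf _ _ _ _ _ n _ la mu (size la + size mu)./2) ?even_halfK //.
rewrite pfaffian_seq_pf //; set L := joint la (rev mu).
have szL : size L = (size la + size mu)%N by rewrite size_cat !size_map size_rev.
(* the block matrix is the matrix of pf_entry along the sequence L *)
have -> : L = map (fun i : 'I_(size la + size mu) => nth (inl 0%N) L i) (enum 'I_(size la + size mu)).
  rewrite (map_comp (nth (inl 0%N) L) val) val_enum_ord -szL; exact/esym/mkseq_nth.
rewrite seq_pf_map; apply: seq_pf_ext => i j.
have row a b : a \in la -> Qrow k x (a%:Z - b%:Z) = shift_by b (Qgrid_row k x W n) a.
  move=> /(allP laW) aW; rewrite /shift_by; case: leqP => ab; last first.
    by have -> : (a%:Z - b%:Z) = Negz (b - a).-1 by lia.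
  have -> : (a%:Z - b%:Z) = Posz (a - b) by lia.
  by rewrite /Qrow QZ //= andbT (leq_trans (leq_subr _ _)).
have pair a b : a \in la -> b \in la -> Qpair k x a b = Qgrid_pair k x W n a b.
  move=> /(allP laW) aW /(allP laW) bW; rewrite /Qpair /Qgrid_pair.
  by case: ltngtP => // lt; rewrite QZ //= ?lt ?aW ?bW.
have Ll (p : 'I_(size la)) : nth (inl 0%N) L (lshift (size mu) p) = inl (nth 0%N la p).
  by rewrite nth_cat size_map /= ltn_ord (nth_map 0%N).
have Lr (p : 'I_(size mu)) : nth (inl 0%N) L (rshift (size la) p) = inr (nth 0%N mu (size mu - p.+1)).
  by rewrite nth_cat size_map /= ltnNge leq_addr /= addKn (nth_map 0%N) ?size_rev // nth_rev.
case: (split_ordP i) => p ->; case: (split_ordP j) => q ->; rewrite ?Ll ?Lr.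
- by rewrite block_mxEul mxE pair // mem_nth.
- by rewrite block_mxEur mxE row // mem_nth.
- by rewrite block_mxEdl !mxE row // mem_nth.
- by rewrite block_mxEdr mxE.
Qed.
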